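(* Let $a,b\in\mathbb{C}\setminus\{0\}$ with $a,b\notin q^{-\mathbb{N}}$. For $n\in\mathbb{N}$ define the polynomial $$m_n(x)=m_n(x;a,b;q)=\frac{1}{(a;q)_n}\;{}_2\varphi_1\!\left(q^{-n},-bx;\,b;\,q,\,aq^n\right).$$ Let $t_-<0$ and $t_+>0$ be such that $(-ax,-bx;q)_\infty$ has no zeroes for $x\in t_-q^{\mathbb{Z}}\cup t_+q^{\mathbb{Z}}$. Then for all $n,m\in\mathbb{N}$ $$\int_{\infty(t_-)}^{\infty(t_+)} m_n(x)\,m_m(x)\,\frac{(-qx;q)_\infty}{(-ax,-bx;q)_\infty}\,d_qx=\delta_{n,m}\,h_n(a,b)\,I(a,b;t_-,t_+),\qquad h_n(a,b)=\frac{q^{-n}(q;q)_n}{(a,b;q)_n},$$ where $$I(a,b;t_-,t_+)=(1-q)\,t_+\,\frac{(q;q)_\infty}{(a,b;q)_\infty}\,\frac{\theta(abt_-t_+,\,t_-/t_+,\,a,\,b)}{\theta(-at_+,-at_-,-bt_+,-bt_-)}.$$ In particular this holds for $t_-=-1$: if $t>0$ and $(-ax,-bx;q)_\infty$ has no zeroes for $x\in -q^{\mathbb{N}}\cup tq^{\mathbb{Z}}$, then for all $n,m\in\mathbb{N}$ $$\int_{-1}^{\infty(t)} m_n(x)\,m_m(x)\,\frac{(-qx;q)_\infty}{(-ax,-bx;q)_\infty}\,d_qx=\delta_{n,m}\,h_n(a,b)\,I(a,b;t),\qquad I(a,b;t)=(1-q)\,t\,\frac{(q;q)_\infty}{(a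,b;q)_\infty}\,\frac{\theta(-abt,-1/t)}{\theta(-at,-bt)}.$$
   Context: Fix $0<q<1$; $\mathbb{N}=\{0,1,2,\dots\}$. Notation: $(x;q)_n=\prod_{k=0}^{n-1}(1-xq^k)$ for $n\in\mathbb{N}\cup\{\infty\}$, $(x_1,\dots,x_k;q)_n=\prod_j (x_j;q)_n$; $\theta(x)=(x,q/x;q)_\infty$ for $x\neq0$, $\theta(x_1,\dots,x_k)=\prod_j\theta(x_j)$; and ${}_2\varphi_1(A,B;C;q,z)=\sum_{k\ge0}\frac{(A,B;q)_k}{(q,C;q)_k}z^k$ (here terminating). Jackson $q$-integrals: for $\alpha,\beta\ne0$, $\int_0^{\alpha}f(x)\,d_qx=(1-q)\sum_{k=0}^\infty f(\alpha q^k)\alpha q^k$, $\int_0^{\infty(\alpha)}f(x)\,d_qx=(1-q)\sum_{k=-\infty}^{\infty}f(\alpha q^k)\alpha q^k$, $\int_{\infty(\beta)}^{\infty(\alpha)}=\int_0^{\infty(\alpha)}-\int_0^{\infty(\beta)}$, and $\int_{-1}^{\infty(t)}f(x)\,d_qx=\int_0^{\infty(t)}f(x)\,d_qx-\int_0^{-1}f(x)\,d_qx=(1-q)\sum_{k\in\mathbb{Z}}f(tq^k)tq^k+(1-q)\sum_{k\ge0}f(-q^k)q^k$ (absolutely convergent sums). *)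

(* Defs.v *)
From Stdlib Require Export Reals ZArith.
From Coquelicot Require Export Coquelicot.

Open Scope R_scope.
Open Scope C_scope.

(** Limits and sums of complex sequences, taken on real and imaginary parts as
    in Coquelicot's [C_lim]; they carry the intended value only when the
    sequence (resp. series) converges. *)
Definition CLim_seq (u : nat -> C) : C :=
  (real (Lim_seq (fun n => fst (u n))), real (Lim_seq (fun n => snd (u n)))).

Definition CSeries (u : nat -> C) : C :=
  (Series (fun n => fst (u n)), Series (fun n => snd (u n))).

Definition abs_summable (u : nat -> C) : Prop :=
  ex_series (fun n => Cmod (u n)).

(** [Z] is split into [0, 1, 2, ...] and [-1, -2, ...]. *)
Definition CSeriesZ (u : Z -> C) : C :=
  CSeries (fun n => u (Z.of_nat n)) + CSeries (fun n => u (- Z.of_nat (S n))%Z).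

Definition abs_summableZ (u : Z -> C) : Prop :=
  abs_summable (fun n => u (Z.of_nat n)) /\
  abs_summable (fun n => u (- Z.of_nat (S n))%Z).

(** [(x; q)_n] and [(x; q)_oo]. *)
Fixpoint qpoch (q : R) (x : C) (n : nat) : C :=
  match n with
  | O => 1
  | S k => qpoch q x k * (1 - x * RtoC (q ^ k)%R)
  end.

Definition qpoch_inf (q : R) (x : C) : C := CLim_seq (qpoch q x).

Definition theta (q : R) (x : C) : C := qpoch_inf q x * qpoch_inf q (q / x).

(** The basic hypergeometric series [2phi1(A, B; c; q, z)]. *)
Definition phi21 (q : R) (A B c z : C) : C :=
  CSeries (fun k =>
    (qpoch q A k * qpoch q B k) / (qpoch q q k * qpoch q c k) * z ^ k).

(** [qgrid q alpha k] is [alpha q^k]. *)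
Definition qgrid (q : R) (alpha : C) (k : Z) : C := alpha * RtoC (powerRZ q k).

(** Terms of the Jackson sums, without the factor [1 - q]. *)
Definition jackson_term (q : R) (f : C -> C) (alpha : C) (k : Z) : C :=
  f (qgrid q alpha k) * qgrid q alpha k.

(** Integral from [0] to [alpha]. *)
Definition jackson (q : R) (f : C -> C) (alpha : C) : C :=
  (1 - q) * CSeries (fun k => jackson_term q f alpha (Z.of_nat k)).

Definition ex_jackson (q : R) (f : C -> C) (alpha : C) : Prop :=
  abs_summable (fun k => jackson_term q f alpha (Z.of_nat k)).

(** Integral from [0] to [oo(alpha)]. *)
Definition jackson_inf (q : R) (f : C -> C) (alpha : C) : C :=
  (1 - q) * CSeriesZ (jackson_term q f alpha).

Definition ex_jackson_inf (q : R) (f : C -> C) (alpha : C) : Prop :=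
  abs_summableZ (jackson_term q f alpha).

(** Integral from [oo(beta)] to [oo(alpha)]. *)
Definition jackson_inf_inf (q : R) (f : C -> C) (beta alpha : C) : C :=
  jackson_inf q f alpha - jackson_inf q f beta.

(** Integral from [beta] to [oo(alpha)]. *)
Definition jackson_pt_inf (q : R) (f : C -> C) (beta alpha : C) : C :=
  jackson_inf q f alpha - jackson q f beta.

Definition m_poly (q : R) (a b : C) (n : nat) (x : C) : C :=
  / qpoch q a n
  * phi21 q (RtoC (/ q ^ n)%R) (- b * x) b (a * RtoC (q ^ n)%R).

Definition weight (q : R) (a b x : C) : C :=
  qpoch_inf q (- q * x) / (qpoch_inf q (- a * x) * qpoch_inf q (- b * x)).

Definition h_norm (q : R) (a b : C) (n : nat) : C :=
  RtoC (/ q ^ n)%R * qpoch q q n / (qpoch q a n * qpoch q b n).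

Definition mass2 (q : R) (a b tm tp : C) : C :=
  (1 - q) * tp * (qpoch_inf q q / (qpoch_inf q a * qpoch_inf q b))
  * ((theta q (a * b * tm * tp) * theta q (tm / tp) * theta q a * theta q b)
     / (theta q (- a * tp) * theta q (- a * tm)
        * theta q (- b * tp) * theta q (- b * tm))).

Definition mass1 (q : R) (a b t : C) : C :=
  (1 - q) * t * (qpoch_inf q q / (qpoch_inf q a * qpoch_inf q b))
  * ((theta q (- a * b * t) * theta q (- 1 / t))
     / (theta q (- a * t) * theta q (- b * t))).

Definition Kronecker (n m : nat) : C := if Nat.eqb n m then 1 else 0.

(* Main.v *)
Require Import Defs.
From Stdlib Require Import Lra Lia Classical FunctionalExtensionality.

(** The integrals are sums over the grids [x = t q^k], [k] an integer. Write [w] for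
    the weight, [S(t)] for the sum of [w(x) x] over the grid of [t], and
    [V(t) = theta(-at) theta(-bt)].

    Orthogonality. The weight satisfies [(1 + qx) w(qx) = (1 + ax)(1 + bx) w(x)].
    Telescoping along the grid turns this into two contiguous relations for the
    moments [L[(-ax;q)_i (-bx;q)_j w]], where [L] is the integral; they express all
    moments by the total mass [L[w]]. In the basis of the [(-bx;q)_k] the coefficients
    of [m_n] are, up to the factors produced by these relations, signed Gaussian
    binomials, so the finite q-binomial theorem makes [L[m_n (-ax;q)_i w]] a multiple
    of [(q^-i;q)_n], which is zero for [i < n]. Trading the factors of [(-bx;q)_k] for
    factors of [(-ax;q)_i] one at a time ([m_fun_spec]) gives [L[m_n m_m w]] for
    [m <= n], including the norm ([orthogonality]).

    Total mass on two bilateral grids. The function [T = V S] has no denominators: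
    [T(t)] is the sum over [k] of [ell_k(t) P(t q^k)] with
    [ell_k(t) = (ab)^k q^(k^2) t^(2k+1)] and
    [P(x) = (-qx, -q/(ax), -q/(bx); q)_oo]. If [P] is replaced by a monomial, the sum
    is a constant multiple of one of two fixed theta series, according to the parity
    of the exponent. Truncating the three products of [P] therefore shows that [T] is a
    pointwise limit of elements of a fixed two-dimensional space ([theta_sum_lim],
    [in_closure_theta_sum]). The same sum with [(-bx;q)_oo] in place of [(-qx;q)_oo]
    telescopes to [V(t)/a], so [V] is such a limit too, and so is
    [B_s(t) = theta(abst) theta(t/s)], which is [V] for another pair with the same
    product [ab]. Hence the 3x3 determinant of [T], [V], [B_s] vanishes at any three
    points ([in_closure_det3]). At the points [r], [s] and [-1/a], where [B_s(s) = 0]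
    and [V(-1/a) = 0], it gives
    [T(r) V(s) - T(s) V(r)] as a product of theta functions times [T(-1/a)]
    ([wronskian]). The value [T(-1/a)] is found by moving [b] to [b/q^n] and letting
    [n] tend to infinity, where only the term [k = 0] survives ([theta_sum_at_zero]).
    Dividing by [V(r) V(s)] gives [S(r) - S(s)].

    Total mass from [-1]. The factor [(-qx;q)_oo] vanishes at [x = -q^-k], [k >= 1],
    so the one-sided sum [H] over the grid of [-1] also satisfies [V(-1) H = T(-1)]
    and the argument applies if [V(-1) <> 0]. The exceptional case is that [a] or
    [b] is a power [q^(i+1)]. There the contiguous relation, satisfied by both sides
    of the formula, allows induction on [i], starting from [a = q], where
    [w = 1/(-bx;q)_oo] and the sum telescopes ([mass1_q_power]). *)

(** * Limits of complex sequences *)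

Lemma Cmult_reg_l (r x y : C) : r <> 0 -> r * x = r * y -> x = y.
Proof.
  intros hr H. replace x with (/ r * (r * x)) by (field; auto).
  rewrite H. field; auto.
Qed.

Lemma Copp_neq_0 (x : C) : x <> 0 -> - x <> 0.
Proof. intros h E. apply h. replace x with (- - x) by ring. rewrite E. ring. Qed.

Lemma Cinv_neq_0 (x : C) : x <> 0 -> / x <> 0.
Proof. intros h E. apply C1_nz. rewrite <- (Cinv_l _ h), E. ring. Qed.

Lemma Cmult_neq_0_inv (x y : C) : x * y <> 0 -> x <> 0 /\ y <> 0.
Proof. intros h; split; intros E; apply h; rewrite E; ring. Qed.

(** Convergence in modulus, from which limits of real and imaginary parts, and hence
    the value of [CLim_seq], are recovered by [CLim_seq_unique]. *)
Definition Clim (u : nat -> C) (l : C) : Prop :=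
  is_lim_seq (fun n => Cmod (u n - l)) 0.

Lemma is_lim_seq_0_dominated (u v : nat -> R) :
  (forall n, (0 <= u n <= v n)%R) -> is_lim_seq v 0 -> is_lim_seq u 0.
Proof.
  intros H Hv.
  apply is_lim_seq_le_le with (fun _ => 0%R) v; auto.
  apply is_lim_seq_const.
Qed.

Lemma Clim_eventually (u v : nat -> C) l :
  eventually (fun n => u n = v n) -> Clim u l -> Clim v l.
Proof.
  intros H. apply is_lim_seq_ext_loc.
  revert H. apply filter_imp. intros n ->. reflexivity.
Qed.

Lemma Clim_ext (u v : nat -> C) l :
  (forall n, u n = v n) -> Clim u l -> Clim v l.
Proof. intros H. apply Clim_eventually. now exists 0%nat. Qed.

Lemma Clim_const (c : C) : Clim (fun _ => c) c.
Proof.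
  apply is_lim_seq_ext with (fun _ => 0%R); [|apply is_lim_seq_const].
  intros _. replace (c - c) with (RtoC 0) by ring. now rewrite Cmod_0.
Qed.

Lemma Clim_bounded u l :
  Clim u l -> exists M, (0 < M)%R /\ forall n, (Cmod (u n) <= M)%R.
Proof.
  intros H.
  destruct (proj2 (is_lim_seq_spec _ _) H (mkposreal 1 Rlt_0_1)) as [N HN].
  simpl in HN.
  assert (Hf : exists M, forall n, (n < N)%nat -> (Cmod (u n) <= M)%R).
  { clear. induction N as [|N [M IH]].
    - exists 0%R; intros; lia.
    - exists (Rmax M (Cmod (u N))). intros n Hn.
      destruct (Nat.eq_dec n N) as [->|].
      + apply Rmax_r.
      + eapply Rle_trans; [apply IH; lia|apply Rmax_l]. }
  destruct Hf as [M HM].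
  exists (Rmax M (Cmod l + 1))%R; split.
  - eapply Rlt_le_trans; [|apply Rmax_r]. generalize (Cmod_ge_0 l); lra.
  - intros n. destruct (Nat.lt_ge_cases n N) as [h|h].
    + eapply Rle_trans; [now apply HM|apply Rmax_l].
    + eapply Rle_trans; [|apply Rmax_r].
      specialize (HN n h). rewrite Rminus_0_r in HN.
      rewrite Rabs_pos_eq in HN by apply Cmod_ge_0.
      replace (u n) with ((u n - l) + l) by ring.
      eapply Rle_trans; [apply Cmod_triangle|lra].
Qed.

Lemma Clim_plus u v l l' :
  Clim u l -> Clim v l' -> Clim (fun n => u n + v n) (l + l').
Proof.
  intros Hu Hv.
  apply is_lim_seq_0_dominated with (fun n => Cmod (u n - l) + Cmod (v n - l'))%R.
  - intros n; split; [apply Cmod_ge_0|].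
    replace (u n + v n - (l + l')) with ((u n - l) + (v n - l')) by ring.
    apply Cmod_triangle.
  - replace 0%R with (0 + 0)%R by ring. now apply is_lim_seq_plus'.
Qed.

Lemma Clim_mult u v l l' :
  Clim u l -> Clim v l' -> Clim (fun n => u n * v n) (l * l').
Proof.
  intros Hu Hv. destruct (Clim_bounded _ _ Hv) as [M [HM0 HM]].
  apply is_lim_seq_0_dominated
    with (fun n => M * Cmod (u n - l) + Cmod l * Cmod (v n - l'))%R.
  - intros n; split; [apply Cmod_ge_0|].
    replace (u n * v n - l * l') with ((u n - l) * v n + l * (v n - l')) by ring.
    eapply Rle_trans; [apply Cmod_triangle|]. rewrite !Cmod_mult.
    apply Rplus_le_compat_r. rewrite Rmult_comm.
    apply Rmult_le_compat_r; [apply Cmod_ge_0|apply HM].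
  - replace 0%R with (M * 0 + Cmod l * 0)%R by ring.
    apply is_lim_seq_plus'; apply (is_lim_seq_scal_l _ _ 0%R); assumption.
Qed.

Lemma Clim_scal c u l : Clim u l -> Clim (fun n => c * u n) (c * l).
Proof. intros H. apply Clim_mult; [apply Clim_const|exact H]. Qed.

Lemma Clim_minus u v l l' :
  Clim u l -> Clim v l' -> Clim (fun n => u n - v n) (l - l').
Proof.
  intros Hu Hv. apply Clim_ext with (fun n => u n + (-1) * v n).
  - intros n; ring.
  - replace (l - l') with (l + (-1) * l') by ring.
    apply Clim_plus; [exact Hu|now apply Clim_scal].
Qed.

Lemma Clim_unique u l l' : Clim u l -> Clim u l' -> l = l'.
Proof.
  intros H H'.
  assert (H0 := Clim_minus _ _ _ _ H H'). unfold Clim in H0.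
  apply is_lim_seq_ext with (v := fun _ => Cmod (l - l')) in H0.
  - apply is_lim_seq_unique in H0. rewrite Lim_seq_const in H0.
    injection H0 as H0. apply Cmod_eq_0 in H0.
    replace l with ((l - l') + l') by ring. rewrite H0; ring.
  - intros n. rewrite <- (Cmod_opp (l - l')). f_equal. ring.
Qed.

Lemma Clim_subseq u l (g : nat -> nat) :
  (forall n, (n <= g n)%nat) -> Clim u l -> Clim (fun n => u (g n)) l.
Proof.
  intros Hg. apply (is_lim_seq_subseq (fun n => Cmod (u n - l))).
  
  intros P [N HN]. exists N. intros n Hn. apply HN. specialize (Hg n); lia.
Qed.

Lemma Clim_fst (u : nat -> C) (l : C) : Clim u l -> is_lim_seq (fun n => fst (u n)) (fst l).
Proof.
  intros H.
  apply is_lim_seq_ext with (fun n => (fst (u n) - fst l) + fst l)%R; [intros; ring|].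
  replace (Finite (fst l)) with (Finite (0 + fst l)) by (f_equal; ring).
  apply is_lim_seq_plus'; [|apply is_lim_seq_const].
  apply is_lim_seq_abs_0.
  eapply is_lim_seq_0_dominated; [|exact H].
  intros n; split; [apply Rabs_pos|]. exact (re_le_Cmod (u n - l)).
Qed.

Lemma im_le_Cmod (z : C) : (Rabs (snd z) <= Cmod z)%R.
Proof. eapply Rle_trans; [apply Rmax_r|apply Rmax_Cmod]. Qed.

Lemma Clim_snd u l : Clim u l -> is_lim_seq (fun n => snd (u n)) (snd l).
Proof.
  intros H.
  apply is_lim_seq_ext with (fun n => (snd (u n) - snd l) + snd l)%R; [intros; ring|].
  replace (Finite (snd l)) with (Finite (0 + snd l)) by (f_equal; ring).
  apply is_lim_seq_plus'; [|apply is_lim_seq_const].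
  apply is_lim_seq_abs_0.
  eapply is_lim_seq_0_dominated; [|exact H].
  intros n; split; [apply Rabs_pos|]. exact (im_le_Cmod (u n - l)).
Qed.

Lemma Cmod_le_re_im (z : C) : (Cmod z <= Rabs (fst z) + Rabs (snd z))%R.
Proof.
  destruct z as [x y]; simpl.
  replace (x, y) with (RtoC x + Ci * RtoC y)
    by (unfold RtoC, Cplus, Cmult, Ci; simpl; f_equal; ring).
  eapply Rle_trans; [apply Cmod_triangle|].
  rewrite Cmod_mult, !Cmod_R, Cmod_Ci. lra.
Qed.

Lemma Clim_of_parts (u : nat -> C) (l : C) :
  is_lim_seq (fun n => fst (u n)) (fst l) ->
  is_lim_seq (fun n => snd (u n)) (snd l) -> Clim u l.
Proof.
  intros H1 H2.
  apply is_lim_seq_0_dominated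
    with (fun n => Rabs (fst (u n) - fst l) + Rabs (snd (u n) - snd l))%R.
  - intros n; split; [apply Cmod_ge_0|]. apply (Cmod_le_re_im (u n - l)).
  - replace 0%R with (0 + 0)%R by ring.
    apply is_lim_seq_plus'; apply (is_lim_seq_abs_0 (fun n => (_ - _)%R)).
    + replace 0%R with (fst l - fst l)%R by ring.
      apply is_lim_seq_minus'; [exact H1|apply is_lim_seq_const].
    + replace 0%R with (snd l - snd l)%R by ring.
      apply is_lim_seq_minus'; [exact H2|apply is_lim_seq_const].
Qed.

Lemma CLim_seq_unique u l : Clim u l -> CLim_seq u = l.
Proof.
  intros H. unfold CLim_seq.
  rewrite (is_lim_seq_unique _ _ (Clim_fst _ _ H)).
  rewrite (is_lim_seq_unique _ _ (Clim_snd _ _ H)).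
  now destruct l.
Qed.

Lemma Clim_Cmod (u : nat -> C) l :
  Clim u l -> is_lim_seq (fun n => Cmod (u n)) (Cmod l).
Proof.
  intros H.
  apply is_lim_seq_ext with (fun n => (Cmod (u n) - Cmod l) + Cmod l)%R; [intros; ring|].
  replace (Finite (Cmod l)) with (Finite (0 + Cmod l)) by (f_equal; ring).
  apply is_lim_seq_plus'; [|apply is_lim_seq_const].
  apply is_lim_seq_abs_0.
  eapply is_lim_seq_0_dominated; [|exact H].
  intros n; split; [apply Rabs_pos|].
  assert (A := Cmod_triangle (u n - l) l). assert (B := Cmod_triangle (l - u n) (u n)).
  replace (u n - l + l) with (u n) in A by ring.
  replace (l - u n + u n) with l in B by ring.
  replace (l - u n) with (- (u n - l)) in B by ring. rewrite Cmod_opp in B.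
  apply Rabs_le; lra.
Qed.

Lemma Clim_inv_1 (v : nat -> C) : Clim v 1 -> Clim (fun n => / v n) 1.
Proof.
  intros Hv.
  apply (is_lim_seq_le_le_loc (fun _ => 0%R) _ (fun n => 2 * Cmod (v n - 1))%R).
  - assert (h : (0 < / 2)%R) by lra.
    destruct (proj2 (is_lim_seq_spec _ _) Hv (mkposreal _ h)) as [N HN].
    exists N. intros n hn. specialize (HN n hn). simpl in HN.
    rewrite Rminus_0_r, Rabs_pos_eq in HN by apply Cmod_ge_0.
    assert (L : (/ 2 <= Cmod (v n))%R).
    { assert (T := Cmod_triangle (v n) (- (v n - 1))).
      replace (v n + - (v n - 1)) with (RtoC 1) in T by ring.
      rewrite Cmod_1, Cmod_opp in T. lra. }
    assert (vn : v n <> 0) by (intros E; rewrite E, Cmod_0 in L; lra).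
    split; [apply Cmod_ge_0|].
    replace (/ v n - 1) with (- (v n - 1) * / v n) by (field; auto).
    rewrite Cmod_mult, Cmod_opp, Cmod_inv by auto. rewrite Rmult_comm.
    apply Rmult_le_compat_r; [apply Cmod_ge_0|].
    rewrite <- (Rinv_inv 2). apply Rinv_le_contravar; lra.
  - apply is_lim_seq_const.
  - replace (Finite 0) with (Rbar_mult 2 0) by (simpl; f_equal; ring).
    now apply is_lim_seq_scal_l.
Qed.

Lemma Clim_div_1 (u v w : nat -> C) l :
  (forall n, u n * v n = w n) -> Clim v 1 -> Clim w l -> Clim u l.
Proof.
  intros H Hv Hw.
  apply Clim_eventually with (fun n => w n * / v n).
  - assert (h : (0 < 1)%R) by lra.
    destruct (proj2 (is_lim_seq_spec _ _) Hv (mkposreal _ h)) as [N HN].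
    exists N. intros n hn. specialize (HN n hn). simpl in HN.
    rewrite Rminus_0_r, Rabs_pos_eq in HN by apply Cmod_ge_0.
    rewrite <- H. field. intros E. rewrite E in HN.
    replace (0 - 1) with (- (1)) in HN by ring. rewrite Cmod_m1 in HN. lra.
  - rewrite <- (Cmult_1_r l). apply Clim_mult; [exact Hw|now apply Clim_inv_1].
Qed.

(** * Absolutely summable series *)

Lemma abs_summable_le (u : nat -> C) (v : nat -> R) :
  (forall n, (Cmod (u n) <= v n)%R) -> ex_series v -> abs_summable u.
Proof.
  intros H Hv. apply (ex_series_le (fun n => Cmod (u n)) v); [|exact Hv].
  intros n. change (norm (Cmod (u n))) with (Rabs (Cmod (u n))).
  rewrite Rabs_pos_eq; auto using Cmod_ge_0.
Qed.

Lemma abs_summable_ext (u v : nat -> C) :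
  (forall n, u n = v n) -> abs_summable u -> abs_summable v.
Proof. intros H. apply ex_series_ext. intros n; now rewrite H. Qed.

Lemma abs_summable_plus u v :
  abs_summable u -> abs_summable v -> abs_summable (fun n => u n + v n).
Proof.
  intros Hu Hv. apply abs_summable_le with (fun n => Cmod (u n) + Cmod (v n))%R.
  - intros; apply Cmod_triangle.
  - now apply (ex_series_plus (fun n => Cmod (u n))).
Qed.

Lemma abs_summable_scal c u : abs_summable u -> abs_summable (fun n => c * u n).
Proof.
  intros Hu. apply abs_summable_le with (fun n => Cmod c * Cmod (u n))%R.
  - intros; rewrite Cmod_mult; lra.
  - now apply (ex_series_scal_l (Cmod c) (fun n => Cmod (u n))).
Qed.

Lemma abs_summable_S u :
  abs_summable (fun n => u (S n)) <-> abs_summable u.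
Proof. symmetry. apply (ex_series_incr_1 (fun n => Cmod (u n))). Qed.

Lemma abs_summable_fst u : abs_summable u -> ex_series (fun n => fst (u n)).
Proof.
  intros H. apply (ex_series_le (fun n => fst (u n)) (fun n => Cmod (u n))); [|exact H].
  intros n. apply (re_le_Cmod (u n)).
Qed.

Lemma abs_summable_snd u : abs_summable u -> ex_series (fun n => snd (u n)).
Proof.
  intros H. apply (ex_series_le (fun n => snd (u n)) (fun n => Cmod (u n))); [|exact H].
  intros n. apply im_le_Cmod.
Qed.

Lemma abs_summable_lim0 u : abs_summable u -> Clim u 0.
Proof.
  intros H. apply ex_series_lim_0 in H.
  apply is_lim_seq_ext with (2 := H). intros n. f_equal; ring.
Qed.

Lemma CSeries_ext u v : (forall n, u n = v n) -> CSeries u = CSeries v.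
Proof.
  intros H. unfold CSeries. f_equal; apply Series_ext; intros n; now rewrite H.
Qed.

Lemma CSeries_plus u v :
  abs_summable u -> abs_summable v ->
  CSeries (fun n => u n + v n) = CSeries u + CSeries v.
Proof.
  intros Hu Hv. unfold CSeries, Cplus; simpl. f_equal; apply Series_plus;
    auto using abs_summable_fst, abs_summable_snd.
Qed.

Lemma CSeries_scal c u :
  abs_summable u -> CSeries (fun n => c * u n) = c * CSeries u.
Proof.
  intros Hu. destruct c as [c1 c2].
  assert (H1 := abs_summable_fst _ Hu). assert (H2 := abs_summable_snd _ Hu).
  unfold CSeries, Cmult; simpl. f_equal.
  - rewrite Series_minus;
      [|exact (ex_series_scal_l c1 _ H1)|exact (ex_series_scal_l c2 _ H2)].
    now rewrite !Series_scal_l.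
  - rewrite Series_plus;
      [|exact (ex_series_scal_l c1 _ H2)|exact (ex_series_scal_l c2 _ H1)].
    now rewrite !Series_scal_l.
Qed.

Lemma CSeries_S u :
  abs_summable u -> CSeries u = u 0%nat + CSeries (fun n => u (S n)).
Proof.
  intros Hu. unfold CSeries.
  rewrite (Series_incr_1 (fun n => fst (u n))) by now apply abs_summable_fst.
  rewrite (Series_incr_1 (fun n => snd (u n))) by now apply abs_summable_snd.
  now destruct (u 0%nat).
Qed.

(** The series is defined through real and imaginary parts, which costs the factor 2. *)
Lemma CSeries_bound u :
  abs_summable u -> (Cmod (CSeries u) <= 2 * Series (fun n => Cmod (u n)))%R.
Proof.
  intros Hu. eapply Rle_trans; [apply Cmod_le_re_im|]. simpl.
  assert (H1 : ex_series (fun n => Rabs (fst (u n)))).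
  { apply (ex_series_le (fun n => Rabs (fst (u n))) (fun n => Cmod (u n))); [|exact Hu].
    intros n. change (Rabs (Rabs (fst (u n))) <= Cmod (u n))%R.
    rewrite Rabs_Rabsolu. apply (re_le_Cmod (u n)). }
  assert (H2 : ex_series (fun n => Rabs (snd (u n)))).
  { apply (ex_series_le (fun n => Rabs (snd (u n))) (fun n => Cmod (u n))); [|exact Hu].
    intros n. change (Rabs (Rabs (snd (u n))) <= Cmod (u n))%R.
    rewrite Rabs_Rabsolu. apply im_le_Cmod. }
  assert (A1 := Series_Rabs _ H1). assert (A2 := Series_Rabs _ H2).
  assert (B1 : (Series (fun n => Rabs (fst (u n))) <= Series (fun n => Cmod (u n)))%R).
  { apply Series_le; [|exact Hu]. intros n; split; [apply Rabs_pos|apply (re_le_Cmod (u n))].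
    }
  assert (B2 : (Series (fun n => Rabs (snd (u n))) <= Series (fun n => Cmod (u n)))%R).
  { apply Series_le; [|exact Hu]. intros n; split; [apply Rabs_pos|apply im_le_Cmod]. }
  lra.
Qed.

Lemma Series_telescope (g : nat -> R) (l : R) :
  is_lim_seq g l -> Series (fun n => g n - g (S n))%R = (g 0%nat - l)%R.
Proof.
  intros H. apply is_series_unique.
  change (is_lim_seq (sum_n (fun n => g n - g (S n))%R) (g 0%nat - l)%R).
  apply is_lim_seq_ext with (fun n => g 0%nat - g (S n))%R.
  - intros n. induction n as [|n IH].
    + now rewrite sum_O.
    + rewrite sum_Sn, <- IH. change plus with Rplus. ring.
  - apply is_lim_seq_minus'; [apply is_lim_seq_const|].
    now apply (is_lim_seq_incr_1 g).
Qed.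

Lemma CSeries_telescope (g : nat -> C) l :
  Clim g l -> CSeries (fun n => g n - g (S n)) = g 0%nat - l.
Proof.
  intros H. unfold CSeries. simpl.
  replace (g 0%nat - l) with (fst (g 0%nat) - fst l, snd (g 0%nat) - snd l)%R
    by reflexivity.
  f_equal.
  - exact (Series_telescope _ _ (Clim_fst _ _ H)).
  - exact (Series_telescope _ _ (Clim_snd _ _ H)).
Qed.

(** A sequence with absolutely summable increments converges, its real and imaginary
    parts being partial sums of convergent series. *)
Lemma Clim_of_increments (u : nat -> C) :
  abs_summable (fun n => u (S n) - u n) -> exists l, Clim u l.
Proof.
  intros H.
  assert (T : forall g : nat -> R, ex_series (fun n => g (S n) - g n)%R ->
            exists l : R, is_lim_seq g l).
  { intros g [l Hl]. exists (l + g 0%nat)%R.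
    apply is_lim_seq_incr_1.
    apply is_lim_seq_ext with (fun n => sum_n (fun n => g (S n) - g n)%R n + g 0%nat)%R.
    - intros n. induction n as [|n IH].
      + rewrite sum_O. ring.
      + rewrite sum_Sn. change plus with Rplus. lra.
    - apply is_lim_seq_plus'; [exact Hl|apply is_lim_seq_const]. }
  destruct (T _ (abs_summable_fst _ H)) as [l1 H1].
  destruct (T _ (abs_summable_snd _ H)) as [l2 H2].
  exists (l1, l2). now apply Clim_of_parts.
Qed.

Lemma ex_series_ratio (u : nat -> R) (r : R) (N : nat) :
  (forall n, (0 <= u n)%R) -> (0 <= r < 1)%R ->
  (forall n, (N <= n)%nat -> (u (S n) <= r * u n)%R) -> ex_series u.
Proof.
  intros H0 Hr H.
  apply (ex_series_incr_n u N).
  apply (ex_series_le (fun n => u (N + n)%nat) (fun n => u N * r ^ n)%R).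
  - intros n. change (norm (u (N + n)%nat)) with (Rabs (u (N + n)%nat)).
    rewrite Rabs_pos_eq by apply H0.
    induction n as [|n IH].
    + rewrite Nat.add_0_r; simpl; lra.
    + rewrite Nat.add_succ_r. eapply Rle_trans; [apply H; lia|].
      simpl. replace (u N * (r * r ^ n))%R with (r * (u N * r ^ n))%R by ring.
      apply Rmult_le_compat_l; [lra|exact IH].
  - apply (ex_series_scal_l (u N) (fun n => r ^ n)%R).
    apply ex_series_geom. rewrite Rabs_pos_eq; lra.
Qed.

(** Tannery: the tail of the majorant is small uniformly in [N], and the finitely many
    other terms tend to zero. *)
Lemma Series_tannery_0 (v : nat -> nat -> R) (D : nat -> R) :
  (forall N k, (0 <= v N k <= D k)%R) -> ex_series D ->
  (forall k, is_lim_seq (fun N => v N k) 0) ->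
  is_lim_seq (fun N => Series (v N)) 0.
Proof.
  intros Hv HD Hl.
  assert (Hex : forall N, ex_series (v N)).
  { intros N. apply (ex_series_le (v N) D); [|exact HD]. intros k.
    change (norm (v N k)) with (Rabs (v N k)). rewrite Rabs_pos_eq; apply Hv. }
  assert (sum_one_sided : forall K, is_lim_seq (fun N => sum_f_R0 (v N) K) 0).
  { induction K as [|K IH]; simpl; [apply Hl|].
    replace 0%R with (0 + 0)%R by ring. now apply is_lim_seq_plus'. }
  apply is_lim_seq_spec; intros eps.
  assert (Htail : exists K, (Series (fun k => D (S K + k)%nat) < eps / 2)%R).
  { assert (L : is_lim_seq (fun n => sum_n D n) (Series D))
      by exact (Series_correct _ HD).
    assert (Heps : (0 < eps / 2)%R) by (destruct eps; simpl; lra).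
    destruct (proj2 (is_lim_seq_spec _ _) L (mkposreal _ Heps)) as [K HK].
    exists K. specialize (HK K (le_n K)). simpl in HK.
    assert (E := Series_incr_n D (S K) (Nat.lt_0_succ K) HD). simpl pred in E.
    rewrite <- sum_n_Reals in E.
    apply Rabs_def2 in HK. lra. }
  destruct Htail as [K HK].
  assert (Heps : (0 < eps / 2)%R) by (destruct eps; simpl; lra).
  destruct (proj2 (is_lim_seq_spec _ _) (sum_one_sided K) (mkposreal _ Heps)) as [N0 HN].
  exists N0. intros N hN. specialize (HN N hN). simpl in HN.
  rewrite (Series_incr_n (v N) (S K) (Nat.lt_0_succ K) (Hex N)). simpl pred.
  assert (T : (0 <= Series (fun k => v N (S K + k)%nat)
                <= Series (fun k => D (S K + k)%nat))%R).
  { split.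
    - replace 0%R with (Series (fun _ => 0 * 0))%R by (rewrite Series_scal_l; ring).
      apply Series_le; [|now apply (ex_series_incr_n (v N) (S K))].
      intros k; split; [lra|rewrite Rmult_0_l; apply Hv].
    - apply Series_le; [intros; apply Hv|now apply (ex_series_incr_n D (S K))]. }
  rewrite Rminus_0_r in *.
  apply Rabs_def2 in HN. apply Rabs_def1; lra.
Qed.

Lemma CSeries_tannery (u : nat -> nat -> C) (v : nat -> C) (D : nat -> R) :
  (forall N k, (Cmod (u N k) <= D k)%R) -> ex_series D ->
  (forall k, Clim (fun N => u N k) (v k)) ->
  Clim (fun N => CSeries (u N)) (CSeries v) /\ abs_summable v.
Proof.
  intros Hu HD Hl.
  assert (Hv : forall k, (Cmod (v k) <= D k)%R).
  { intros k.
    assert (L : is_lim_seq (fun N => D k + Cmod (u N k - v k))%R (D k)).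
    { replace (Finite (D k)) with (Finite (D k + 0)) by (f_equal; ring).
      apply is_lim_seq_plus'; [apply is_lim_seq_const|apply Hl]. }
    apply (is_lim_seq_le (fun _ => Cmod (v k)) _ (Cmod (v k)) (D k)) in L.
    - exact L.
    - intros N. replace (v k) with (u N k + - (u N k - v k)) at 1 by ring.
      eapply Rle_trans; [apply Cmod_triangle|]. rewrite Cmod_opp.
      specialize (Hu N k); lra.
    - apply is_lim_seq_const. }
  assert (Sv : abs_summable v) by (apply abs_summable_le with D; auto).
  assert (Su : forall N, abs_summable (u N)) by (intros; apply abs_summable_le with D; auto).
  split; [|exact Sv].
  apply is_lim_seq_0_dominated
    with (fun N => 2 * Series (fun k => Cmod (u N k - v k)))%R.
  - intros N; split; [apply Cmod_ge_0|].
    assert (S1 : abs_summable (fun k => (-1) * v k)) by now apply abs_summable_scal.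
    replace (CSeries (u N) - CSeries v) with (CSeries (fun k => u N k - v k)).
    + apply CSeries_bound. apply abs_summable_ext with (fun k => u N k + (-1) * v k).
      * intros; ring.
      * now apply abs_summable_plus.
    + rewrite (CSeries_ext _ (fun k => u N k + (-1) * v k)) by (intros; ring).
      rewrite CSeries_plus, CSeries_scal by auto. ring.
  - replace (Finite 0) with (Rbar_mult 2 0) by (simpl; f_equal; ring).
    apply is_lim_seq_scal_l.
    apply Series_tannery_0 with (fun k => 2 * D k)%R.
    + intros N k; split; [apply Cmod_ge_0|].
      eapply Rle_trans; [apply Cmod_triangle|]. rewrite Cmod_opp.
      specialize (Hu N k). specialize (Hv k). lra.
    + now apply (ex_series_scal_l 2%R D).
    + exact Hl.
Qed.

(** * Bilateral series *)

Lemma abs_summableZ_ext (u v : Z -> C) :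
  (forall k, u k = v k) -> abs_summableZ u -> abs_summableZ v.
Proof.
  intros H [H1 H2]; split; [revert H1|revert H2]; apply abs_summable_ext; intros; apply H.
Qed.

Lemma abs_summableZ_plus u v :
  abs_summableZ u -> abs_summableZ v -> abs_summableZ (fun k => u k + v k).
Proof.
  intros [H1 H2] [H3 H4]; split; now apply (abs_summable_plus (fun n => u _)).
Qed.

Lemma abs_summableZ_scal c u :
  abs_summableZ u -> abs_summableZ (fun k => c * u k).
Proof. intros [H1 H2]; split; now apply (abs_summable_scal c (fun n => u _)). Qed.

Lemma CSeriesZ_ext u v : (forall k, u k = v k) -> CSeriesZ u = CSeriesZ v.
Proof. intros H. unfold CSeriesZ. f_equal; apply CSeries_ext; intros; apply H. Qed.

Lemma CSeriesZ_plus u v :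
  abs_summableZ u -> abs_summableZ v ->
  CSeriesZ (fun k => u k + v k) = CSeriesZ u + CSeriesZ v.
Proof.
  intros [H1 H2] [H3 H4]. unfold CSeriesZ.
  rewrite (CSeries_plus (fun n => u (Z.of_nat n))) by auto.
  rewrite (CSeries_plus (fun n => u (- Z.of_nat (S n))%Z)) by auto. ring.
Qed.

Lemma CSeriesZ_scal c u :
  abs_summableZ u -> CSeriesZ (fun k => c * u k) = c * CSeriesZ u.
Proof.
  intros [H1 H2]. unfold CSeriesZ.
  rewrite (CSeries_scal c (fun n => u (Z.of_nat n))) by auto.
  rewrite (CSeries_scal c (fun n => u (- Z.of_nat (S n))%Z)) by auto. ring.
Qed.

Lemma abs_summableZ_shift u :
  abs_summableZ u -> abs_summableZ (fun k => u (k + 1)%Z).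
Proof.
  intros [H1 H2]. split.
  - apply abs_summable_S in H1. revert H1. apply abs_summable_ext.
    intros n; f_equal; lia.
  - apply abs_summable_S.
    revert H2. apply abs_summable_ext. intros n; f_equal; lia.
Qed.

Lemma CSeriesZ_shift u :
  abs_summableZ u -> CSeriesZ (fun k => u (k + 1)%Z) = CSeriesZ u.
Proof.
  intros H. destruct (abs_summableZ_shift _ H) as [H3 H4]. destruct H as [H1 H2].
  unfold CSeriesZ.
  rewrite (CSeries_S (fun n => u (Z.of_nat n))) by auto.
  rewrite (CSeries_S (fun n => u (- Z.of_nat (S n) + 1)%Z)) by auto.
  replace (- Z.of_nat 1 + 1)%Z with (Z.of_nat 0) by lia.
  rewrite (CSeries_ext (fun n => u (Z.of_nat n + 1)%Z) (fun n => u (Z.of_nat (S n))))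
    by (intros; f_equal; lia).
  rewrite (CSeries_ext (fun n => u (- Z.of_nat (S (S n)) + 1)%Z)
             (fun n => u (- Z.of_nat (S n))%Z)) by (intros; f_equal; lia).
  ring.
Qed.

Lemma CSeriesZ_telescope (g : Z -> C) l l' :
  Clim (fun n => g (Z.of_nat n)) l -> Clim (fun n => g (- Z.of_nat n)%Z) l' ->
  CSeriesZ (fun k => g k - g (k + 1)%Z) = l' - l.
Proof.
  intros H H'. unfold CSeriesZ.
  rewrite (CSeries_ext _ (fun n => g (Z.of_nat n) - g (Z.of_nat (S n))))
    by (intros; do 2 f_equal; lia).
  rewrite (CSeries_telescope (fun n => g (Z.of_nat n)) l) by exact H.
  assert (H2 := CSeries_telescope (fun n => (-1) * g (- Z.of_nat n)%Z) ((-1) * l')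
                  (Clim_scal _ _ _ H')).
  rewrite (CSeries_ext _ (fun n => (-1) * g (- Z.of_nat n)%Z - (-1) * g
      (- Z.of_nat (S n))%Z)).
  - rewrite H2. simpl. ring.
  - intros n. replace (- Z.of_nat (S n) + 1)%Z with (- Z.of_nat n)%Z by lia. ring.
Qed.

Definition ex_seriesZ (D : Z -> R) : Prop :=
  ex_series (fun n => D (Z.of_nat n)) /\ ex_series (fun n => D (- Z.of_nat (S n))%Z).

Lemma abs_summableZ_le (u : Z -> C) (D : Z -> R) :
  (forall k, (Cmod (u k) <= D k)%R) -> ex_seriesZ D -> abs_summableZ u.
Proof.
  intros H [H1 H2]; split;
    [apply abs_summable_le with (fun n => D (Z.of_nat n))
    |apply abs_summable_le with (fun n => D (- Z.of_nat (S n))%Z)]; auto.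
Qed.

Lemma CSeriesZ_tannery (u : nat -> Z -> C) (v : Z -> C) (D : Z -> R) :
  (forall N k, (Cmod (u N k) <= D k)%R) -> ex_seriesZ D ->
  (forall k, Clim (fun N => u N k) (v k)) ->
  Clim (fun N => CSeriesZ (u N)) (CSeriesZ v) /\ abs_summableZ v.
Proof.
  intros Hu [H1 H2] Hl.
  destruct (CSeries_tannery (fun N n => u N (Z.of_nat n)) (fun n => v (Z.of_nat n))
              (fun n => D (Z.of_nat n))) as [A1 A2]; auto.
  destruct (CSeries_tannery (fun N n => u N (- Z.of_nat (S n))%Z)
              (fun n => v (- Z.of_nat (S n))%Z)
              (fun n => D (- Z.of_nat (S n))%Z)) as [B1 B2]; auto.
  split; [|split; assumption].
  now apply Clim_plus.
Qed.

Lemma abs_summableZ_unshift (u : Z -> C) :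
  abs_summableZ (fun k => u (k + 1)%Z) -> abs_summableZ u.
Proof.
  intros [H1 H2]. split.
  - apply abs_summable_S. revert H1. apply abs_summable_ext. intros n; f_equal; lia.
  - apply abs_summable_S in H2. revert H2. apply abs_summable_ext.
    intros n; f_equal; lia.
Qed.

Lemma abs_summableZ_lim_neg (u : Z -> C) :
  abs_summableZ u -> Clim (fun n => u (- Z.of_nat n)%Z) 0.
Proof.
  intros [_ H]. apply abs_summable_lim0.
  exact (proj1 (abs_summable_S (fun n => u (- Z.of_nat n)%Z)) H).
Qed.

Lemma CSeriesZ_single (u : Z -> C) :
  (forall k, k <> 0%Z -> u k = 0) -> CSeriesZ u = u 0%Z.
Proof.
  intros H.
  assert (Z0 : CSeries (fun _ => 0) = 0).
  { rewrite (CSeries_ext _ (fun n => (fun _ => 0) n - (fun _ => 0) (S n)))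
      by (intros; ring).
    rewrite (CSeries_telescope (fun _ => 0) 0) by apply Clim_const. ring. }
  unfold CSeriesZ.
  rewrite (CSeries_ext (fun n => u (- Z.of_nat (S n))%Z) (fun _ => 0))
    by (intros; apply H; lia).
  rewrite Z0.
  rewrite (CSeries_ext _ (fun n => (fun n => match n with O => u 0%Z | S _ => 0 end) n
      - (fun n => match n with O => u 0%Z | S _ => 0 end) (S n))).
  - rewrite (CSeries_telescope (fun n => match n with O => u 0%Z | S _ => 0 end) 0).
    + ring.
    + apply Clim_eventually with (fun _ => 0); [|apply Clim_const].
      exists 1%nat. intros [|n] h; [lia|reflexivity].
  - intros [|n]; [simpl; ring|]. rewrite H by lia. ring.
Qed.

(** * Infinite q-shifted factorials *)

Section QPochhammer.
Context (q : R) (hq : (0 < q < 1)%R).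

Lemma q_neq_0 : RtoC q <> 0.
Proof. intros H. apply RtoC_inj in H. lra. Qed.

Lemma qpow_neq_0 n : RtoC (q ^ n)%R <> 0.
Proof. intros H. apply RtoC_inj in H. apply (pow_nonzero q n); lra. Qed.

Lemma qpow_S n : RtoC (q ^ S n)%R = q * RtoC (q ^ n)%R.
Proof. simpl. apply RtoC_mult. Qed.

Lemma qpow_lim0 : is_lim_seq (fun n => q ^ n)%R 0.
Proof. apply is_lim_seq_geom. rewrite Rabs_pos_eq; lra. Qed.

Lemma qpoch_S_first (x : C) n : qpoch q x (S n) = (1 - x) * qpoch q (x * q) n.
Proof.
  induction n as [|n IH].
  - simpl. ring.
  - change (qpoch q x (S (S n))) with (qpoch q x (S n) * (1 - x * RtoC (q ^ S n)%R)).
    rewrite IH. simpl qpoch. rewrite qpow_S. ring.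
Qed.

Lemma qpoch_add (x : C) m n :
  qpoch q x (m + n) = qpoch q x m * qpoch q (x * RtoC (q ^ m)%R) n.
Proof.
  induction n as [|n IH].
  - rewrite Nat.add_0_r. simpl. ring.
  - rewrite Nat.add_succ_r. simpl qpoch. rewrite IH, pow_add, RtoC_mult. ring.
Qed.

(** [(-r;q)_n] as a real number: it dominates [(x;q)_n] for [|x| <= r] and is
    increasing in [n] and in [r >= 0]. *)
Fixpoint rpoch (r : R) (n : nat) : R :=
  match n with
  | O => 1%R
  | S k => (rpoch r k * (1 + r * q ^ k))%R
  end.

Lemma qk_pos n : (0 < q ^ n)%R.
Proof. apply pow_lt; lra. Qed.

Lemma rpoch_ge1 r n : (0 <= r)%R -> (1 <= rpoch r n)%R.
Proof.
  intros hr. induction n as [|n IH]; simpl; [lra|].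
  assert (0 <= r * q ^ n)%R by (apply Rmult_le_pos; [lra|left; apply qk_pos]). nra.
Qed.

Lemma rpoch_incr r n : (0 <= r)%R -> (rpoch r n <= rpoch r (S n))%R.
Proof.
  intros hr. simpl. assert (H := rpoch_ge1 r n hr).
  assert (0 <= r * q ^ n)%R by (apply Rmult_le_pos; [lra|left; apply qk_pos]). nra.
Qed.

Lemma rpoch_le_exp r n : (0 <= r)%R -> (rpoch r n <= exp (r / (1 - q)))%R.
Proof.
  intros hr.
  assert (H : (rpoch r n <= exp (r * (1 - q ^ n) / (1 - q)))%R).
  { induction n as [|n IH].
    - simpl. replace (r * (1 - 1) / (1 - q))%R with 0%R by (field; lra).
      rewrite exp_0; lra.
    - simpl.
      replace (r * (1 - q * q ^ n) / (1 - q))%R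
        with (r * (1 - q ^ n) / (1 - q) + r * q ^ n)%R by (field; lra).
      rewrite exp_plus.
      assert (0 <= r * q ^ n)%R by (apply Rmult_le_pos; [lra|left; apply qk_pos]).
      apply Rmult_le_compat; [|lra|exact IH|].
      + generalize (rpoch_ge1 r n hr); lra.
      + apply exp_ineq1_le. }
  eapply Rle_trans; [exact H|].
  assert (H2 : (r * (1 - q ^ n) / (1 - q) <= r / (1 - q))%R).
  { unfold Rdiv. apply Rmult_le_compat_r; [left; apply Rinv_0_lt_compat; lra|].
    assert (H3 := qk_pos n). nra. }
  destruct H2 as [H2|H2].
  - left. now apply exp_increasing.
  - rewrite H2; lra.
Qed.

Lemma qk_le_1 n : (q ^ n <= 1)%R.
Proof. rewrite <- (pow1 n). apply pow_incr; lra. Qed.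

Lemma Cmod_qpow k : Cmod (RtoC (q ^ k)%R) = (q ^ k)%R.
Proof. rewrite Cmod_R, Rabs_pos_eq; [easy|left; apply qk_pos]. Qed.

Lemma Cmod_qpoch_le x n : (Cmod (qpoch q x n) <= rpoch (Cmod x) n)%R.
Proof.
  induction n as [|n IH]; simpl.
  - rewrite Cmod_1; lra.
  - rewrite Cmod_mult. apply Rmult_le_compat; try apply Cmod_ge_0; [exact IH|].
    unfold Cminus. eapply Rle_trans; [apply Cmod_triangle|].
    rewrite Cmod_1, Cmod_opp, Cmod_mult, Cmod_qpow. lra.
Qed.

(** After expansion of both products, each monomial on the left is dominated by the
    corresponding one on the right. *)
Lemma qpoch_minus1_le (x : C) n : (Cmod (qpoch q x n - 1) <= rpoch (Cmod x) n - 1)%R.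
Proof.
  induction n as [|n IH]; simpl.
  - replace (1 - 1) with (RtoC 0) by ring. rewrite Cmod_0; lra.
  - replace (qpoch q x n * (1 - x * RtoC (q ^ n)%R) - 1)
      with ((qpoch q x n - 1) + - (qpoch q x n * (x * RtoC (q ^ n)%R))) by ring.
    eapply Rle_trans; [apply Cmod_triangle|].
    rewrite Cmod_opp, !Cmod_mult, Cmod_qpow.
    assert (H := Cmod_qpoch_le x n).
    assert (0 <= Cmod x * q ^ n)%R
      by (apply Rmult_le_pos; [apply Cmod_ge_0|left; apply qk_pos]). nra.
Qed.

Lemma qpoch_lim (x : C) : Clim (qpoch q x) (qpoch_inf q x).
Proof.
  destruct (Clim_of_increments (qpoch q x)) as [l Hl].
  - apply abs_summable_le
      with (fun n => exp (Cmod x / (1 - q)) * Cmod x * q ^ n)%R.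
    + intros n. simpl.
      replace (qpoch q x n * (1 - x * RtoC (q ^ n)%R) - qpoch q x n)
        with (- (qpoch q x n * (x * RtoC (q ^ n)%R))) by ring.
      rewrite Cmod_opp, !Cmod_mult, Cmod_qpow, Rmult_assoc.
      apply Rmult_le_compat_r.
      * apply Rmult_le_pos; [apply Cmod_ge_0|left; apply qk_pos].
      * eapply Rle_trans; [apply Cmod_qpoch_le|]. apply rpoch_le_exp, Cmod_ge_0.
    + apply (ex_series_scal_l (exp (Cmod x / (1 - q)) * Cmod x)%R (fun n => q ^ n)%R).
      apply ex_series_geom. rewrite Rabs_pos_eq; lra.
  - unfold qpoch_inf. now rewrite (CLim_seq_unique _ _ Hl).
Qed.

Lemma qpoch_inf_step (x y : C) : y = x * q -> qpoch_inf q x = (1 - x) * qpoch_inf q y.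
Proof.
  intros ->. apply Clim_unique with (fun n => qpoch q x (S n)).
  - apply Clim_subseq; [auto|apply qpoch_lim].
  - apply Clim_ext with (fun n => (1 - x) * qpoch q (x * q) n).
    + intros n. now rewrite qpoch_S_first.
    + apply Clim_scal, qpoch_lim.
Qed.

Lemma qpoch_inf_split (x y : C) n :
  y = x * RtoC (q ^ n)%R -> qpoch_inf q x = qpoch q x n * qpoch_inf q y.
Proof.
  intros ->. apply Clim_unique with (fun m => qpoch q x (n + m)).
  - apply (Clim_subseq (qpoch q x) _ (fun m => (n + m)%nat)); [intros; lia|apply qpoch_lim].
  - apply Clim_ext with (fun m => qpoch q x n * qpoch q (x * RtoC (q ^ n)%R) m).
    + intros m. now rewrite qpoch_add.
    + apply Clim_scal, qpoch_lim.
Qed.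

Lemma qpoch_inf_zero (x : C) k : x * RtoC (q ^ k)%R = 1 -> qpoch_inf q x = 0.
Proof.
  intros H. rewrite (qpoch_inf_split x _ (S k) eq_refl). simpl. rewrite H. ring.
Qed.

Lemma qpoch_eq0 (x : C) n : qpoch q x n = 0 -> exists k, (k < n)%nat /\ x * RtoC (q ^ k)%R
    = 1.
Proof.
  induction n as [|n IH]; simpl; intros H.
  - exfalso. now apply C1_nz.
  - destruct (classic (qpoch q x n = 0)) as [H0|H0].
    + destruct (IH H0) as [k [h1 h2]]. exists k; split; [lia|exact h2].
    + exists n; split; [lia|].
      destruct (classic (1 - x * RtoC (q ^ n)%R = 0)) as [H1|H1].
      * symmetry. now apply Ceq_minus.
      * exfalso. now apply (Cmult_neq_0 _ _ H0 H1).
Qed.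

(** Weierstrass: a product of factors at least [1 - c_k], with [c_k >= 0], is at least
    [1 - c_0 - c_1 - ...] as long as this is nonnegative. *)
Lemma qpoch_lower_bound (x : C) n :
  (Cmod x < 1 - q)%R ->
  (1 - Cmod x * (1 - q ^ n) / (1 - q) <= Cmod (qpoch q x n))%R.
Proof.
  intros hx. induction n as [|n IH].
  - simpl. rewrite Cmod_1. replace (1 - 1)%R with 0%R by ring.
    unfold Rdiv. rewrite Rmult_0_r, Rmult_0_l. lra.
  - simpl. rewrite Cmod_mult.
    assert (H0 := Cmod_ge_0 x). assert (Hq := qk_pos n).
    assert (Hq1 := qk_le_1 n).
    assert (H1 : (1 - Cmod x * q ^ n <= Cmod (1 - x * RtoC (q ^ n)%R))%R).
    { assert (T := Cmod_triangle (1 - x * RtoC (q ^ n)%R) (x * RtoC (q ^ n)%R)).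
      replace (1 - x * RtoC (q ^ n)%R + x * RtoC (q ^ n)%R) with (RtoC 1) in T by ring.
      rewrite Cmod_1, Cmod_mult, Cmod_qpow in T. lra. }
    set (s := (Cmod x * (1 - q ^ n) / (1 - q))%R) in *.
    replace (Cmod x * (1 - q * q ^ n) / (1 - q))%R with (s + Cmod x * q ^ n)%R
      by (unfold s; field; lra).
    assert (Hs0 : (0 <= s)%R).
    { unfold s. apply Rmult_le_pos; [nra|left; apply Rinv_0_lt_compat; lra]. }
    assert (Hs1 : (s <= 1)%R).
    { unfold s. apply Rmult_le_reg_r with (1 - q)%R; [lra|].
      unfold Rdiv. rewrite Rmult_assoc, Rinv_l by lra. nra. }
    assert (Hy : (0 <= Cmod x * q ^ n <= 1)%R) by nra.
    apply Rle_trans with ((1 - s) * (1 - Cmod x * q ^ n))%R; [nra|].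
    apply Rmult_le_compat; lra.
Qed.

Lemma qpoch_inf_small_neq0 (x : C) : (Cmod x < 1 - q)%R -> qpoch_inf q x <> 0.
Proof.
  intros hx H.
  assert (L := Clim_Cmod _ _ (qpoch_lim x)). rewrite H, Cmod_0 in L.
  assert (hpos : (0 < 1 - Cmod x / (1 - q))%R).
  { apply Rlt_0_minus. apply Rmult_lt_reg_r with (1 - q)%R; [lra|].
    unfold Rdiv. rewrite Rmult_assoc, Rinv_l by lra. lra. }
  apply (is_lim_seq_le (fun _ => 1 - Cmod x / (1 - q))%R _ (1 - Cmod x / (1 - q))%R 0%R) in L.
  - simpl in L. lra.
  - intros n. eapply Rle_trans; [|now apply qpoch_lower_bound].
    apply Rplus_le_compat_l, Ropp_le_contravar.
    apply Rmult_le_compat_r; [left; apply Rinv_0_lt_compat; lra|].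
    assert (H0 := Cmod_ge_0 x). assert (Hq := qk_pos n). nra.
  - apply is_lim_seq_const.
Qed.

(** Far enough along the product, the remaining infinite product has a small argument
    and cannot vanish, so one of the finitely many initial factors does. *)
Lemma qpoch_inf_eq0 (x : C) : qpoch_inf q x = 0 -> exists k, x * RtoC (q ^ k)%R = 1.
Proof.
  intros H.
  assert (hpos : (0 < (1 - q) / (Cmod x + 1))%R).
  { apply Rdiv_lt_0_compat; [lra|]. generalize (Cmod_ge_0 x); lra. }
  destruct (proj2 (is_lim_seq_spec _ _) qpow_lim0 (mkposreal _ hpos)) as [n Hn].
  specialize (Hn n (le_n n)). simpl in Hn. rewrite Rminus_0_r in Hn.
  rewrite Rabs_pos_eq in Hn by (left; apply qk_pos).
  rewrite (qpoch_inf_split x _ n eq_refl) in H.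
  assert (N : qpoch_inf q (x * RtoC (q ^ n)%R) <> 0).
  { apply qpoch_inf_small_neq0. rewrite Cmod_mult, Cmod_qpow.
    assert (H0 := Cmod_ge_0 x). assert (Hq := qk_pos n).
    apply (Rmult_lt_compat_r (Cmod x + 1)) in Hn; [|lra].
    unfold Rdiv in Hn. rewrite Rmult_assoc, Rinv_l in Hn by lra. nra. }
  destruct (classic (qpoch q x n = 0)) as [H0|H0].
  - destruct (qpoch_eq0 _ _ H0) as [k [_ hk]]. now exists k.
  - exfalso. now apply (Cmult_neq_0 _ _ H0 N).
Qed.

Lemma qpoch_inf_near0 (u : nat -> C) :
  Clim u 0 -> Clim (fun n => qpoch_inf q (u n)) 1.
Proof.
  intros Hu.
  assert (B : forall x, (Cmod (qpoch_inf q x - 1) <= exp (Cmod x / (1 - q)) - 1)%R).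
  { intros x.
    assert (L := Clim_Cmod _ _ (Clim_minus _ _ _ _ (qpoch_lim x) (Clim_const 1))).
    apply (is_lim_seq_le _ (fun _ => exp (Cmod x / (1 - q)) - 1)%R
             _ (exp (Cmod x / (1 - q)) - 1)%R) in L; [exact L| |apply is_lim_seq_const].
    intros n. eapply Rle_trans; [apply qpoch_minus1_le|].
    apply Rplus_le_compat_r, rpoch_le_exp, Cmod_ge_0. }
  apply is_lim_seq_0_dominated with (fun n => exp (Cmod (u n) / (1 - q)) - 1)%R.
  - intros n; split; [apply Cmod_ge_0|apply B].
  - replace 0%R with (exp (0 / (1 - q)) - 1)%R
      by (unfold Rdiv; rewrite Rmult_0_l, exp_0; ring).
    apply is_lim_seq_minus'; [|apply is_lim_seq_const].
    apply is_lim_seq_continuous; [apply derivable_continuous, derivable_exp|].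
    apply is_lim_seq_ext with (fun n => / (1 - q) * Cmod (u n - 0))%R.
    + intros n. replace (u n - 0) with (u n) by ring. unfold Rdiv; ring.
    + replace (0 / (1 - q))%R with (/ (1 - q) * 0)%R by (unfold Rdiv; ring).
      apply (is_lim_seq_scal_l _ _ 0%R). exact Hu.
Qed.

(** [(-r;q)_oo] as a real number. Defined as a modulus, it inherits its functional
    equation from the complex product. *)
Definition rpoch_inf (r : R) : R := Cmod (qpoch_inf q (RtoC (- r))).

Lemma rpoch_lim r : (0 <= r)%R -> is_lim_seq (rpoch r) (rpoch_inf r).
Proof.
  intros hr.
  apply is_lim_seq_ext with (fun n => Cmod (qpoch q (RtoC (- r)) n)).
  - intros n. induction n as [|n IH]; simpl; [apply Cmod_1|].
    rewrite Cmod_mult, IH. f_equal.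
    replace (1 - RtoC (- r) * RtoC (q ^ n)%R) with (RtoC (1 + r * q ^ n)%R)
      by (rewrite RtoC_plus, RtoC_mult, RtoC_opp; ring).
    rewrite Cmod_R, Rabs_pos_eq; [easy|].
    assert (0 <= r * q ^ n)%R by (apply Rmult_le_pos; [lra|left; apply qk_pos]). lra.
  - apply Clim_Cmod, qpoch_lim.
Qed.

Lemma rpoch_le_inf r n : (0 <= r)%R -> (rpoch r n <= rpoch_inf r)%R.
Proof.
  intros hr. apply (is_lim_seq_incr_compare (rpoch r)).
  - now apply rpoch_lim.
  - intros k. now apply rpoch_incr.
Qed.

Lemma rpoch_inf_ge1 r : (0 <= r)%R -> (1 <= rpoch_inf r)%R.
Proof. intros hr. apply (rpoch_le_inf r 0 hr). Qed.

Lemma rpoch_inf_step r s :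
  (0 <= r)%R -> s = (r * q)%R -> rpoch_inf r = ((1 + r) * rpoch_inf s)%R.
Proof.
  intros hr ->. unfold rpoch_inf.
  rewrite (qpoch_inf_step (RtoC (- r)) (RtoC (- (r * q)))).
  - rewrite Cmod_mult. f_equal.
    replace (1 - RtoC (- r)) with (RtoC (1 + r)) by (rewrite RtoC_plus, RtoC_opp; ring).
    rewrite Cmod_R, Rabs_pos_eq; lra.
  - rewrite !RtoC_opp, RtoC_mult; ring.
Qed.

Lemma rpoch_inf_mono r s : (0 <= r <= s)%R -> (rpoch_inf r <= rpoch_inf s)%R.
Proof.
  intros [h1 h2].
  apply (is_lim_seq_le (rpoch r) (rpoch s) (rpoch_inf r) (rpoch_inf s)).
  - intros n. induction n as [|n IH]; simpl; [lra|].
    assert (Hq := qk_pos n). assert (H := rpoch_ge1 r n h1).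
    apply Rmult_le_compat; try nra.
  - now apply rpoch_lim.
  - apply rpoch_lim; lra.
Qed.

Lemma Cmod_qpoch_le_inf x r n :
  (Cmod x <= r)%R -> (Cmod (qpoch q x n) <= rpoch_inf r)%R.
Proof.
  intros h. assert (h0 := Cmod_ge_0 x).
  eapply Rle_trans; [apply Cmod_qpoch_le|].
  eapply Rle_trans; [now apply rpoch_le_inf|]. apply rpoch_inf_mono; lra.
Qed.

Lemma Cmod_qpoch_inf_le x r :
  (Cmod x <= r)%R -> (Cmod (qpoch_inf q x) <= rpoch_inf r)%R.
Proof.
  intros h.
  apply (is_lim_seq_le (fun n => Cmod (qpoch q x n)) (fun _ => rpoch_inf r)
           (Cmod (qpoch_inf q x)) (rpoch_inf r)).
  - intros n. now apply Cmod_qpoch_le_inf.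
  - apply Clim_Cmod, qpoch_lim.
  - apply is_lim_seq_const.
Qed.

(** * The theta function *)

Lemma theta_step (x y : C) : x <> 0 -> y = x * q -> theta q x = - x * theta q y.
Proof.
  intros hx ->. unfold theta. assert (hq0 := q_neq_0).
  rewrite (qpoch_inf_step x (x * q) eq_refl).
  rewrite (qpoch_inf_step (q / (x * q)) (q / x)) by (field; auto).
  field; auto.
Qed.

Lemma theta_inv (x y : C) : x * y = 1 -> theta q y = - y * theta q x.
Proof.
  intros h.
  assert (hx : x <> 0) by (intros ->; rewrite Cmult_0_l in h; symmetry in h;
      now apply C1_nz in h).
  assert (hy : y = / x) by (rewrite <- (Cmult_1_l (/ x)), <- h; field; auto).
  subst y. unfold theta.
  replace (q / / x) with (x * q) by (field; auto).
  replace (q / x) with (/ x * q) by (field; auto).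
  rewrite (qpoch_inf_step x (x * q) eq_refl).
  rewrite (qpoch_inf_step (/ x) (/ x * q) eq_refl).
  field; auto.
Qed.

Lemma theta_1 : theta q 1 = 0.
Proof. unfold theta. rewrite (qpoch_inf_zero 1 0) by (simpl; ring). ring. Qed.

Lemma theta_inv_q (x y : C) : x * y = q -> y <> 0 -> theta q x = theta q y.
Proof.
  intros h hy. assert (hx : x <> 0).
  { intros ->. apply q_neq_0. rewrite <- h. ring. }
  unfold theta. replace (q / x) with y by (rewrite <- h; field; auto).
  replace (q / y) with x by (rewrite <- h; field; auto). ring.
Qed.

End QPochhammer.

(** * Sums over a geometric grid *)

Definition powZ (z : C) (k : Z) : C :=
  match k with
  | Z0 => 1
  | Zpos p => z ^ Pos.to_nat p
  | Zneg p => / z ^ Pos.to_nat p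
  end.

Lemma powZ_succ (z : C) k : z <> 0 -> powZ z (k + 1) = powZ z k * z.
Proof.
  intros hz.
  assert (A : forall n : nat, powZ z (Z.of_nat n) = z ^ n).
  { intros [|n]; [reflexivity|]. simpl. now rewrite SuccNat2Pos.id_succ. }
  assert (B : forall n : nat, powZ z (- Z.of_nat n) = / z ^ n).
  { intros [|n]; [simpl; field|]. simpl. now rewrite SuccNat2Pos.id_succ. }
  destruct (Z_le_gt_dec 0 k) as [h|h].
  - rewrite <- (Z2Nat.id k h).
    replace (Z.of_nat (Z.to_nat k) + 1)%Z with (Z.of_nat (S (Z.to_nat k))) by lia.
    rewrite !A, Cpow_S. ring.
  - replace k with (- Z.of_nat (S (Z.to_nat (- k - 1))))%Z by lia.
    replace (- Z.of_nat (S (Z.to_nat (- k - 1))) + 1)%Z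
      with (- Z.of_nat (Z.to_nat (- k - 1)))%Z by lia.
    rewrite !B, Cpow_S. assert (N := Cpow_nz z (Z.to_nat (- k - 1)) hz).
    field; auto.
Qed.

Lemma powZ_neq_0 (z : C) k : z <> 0 -> powZ z k <> 0.
Proof.
  intros hz. destruct k; simpl; [apply C1_nz|now apply Cpow_nz|].
  assert (N := Cpow_nz z (Pos.to_nat p) hz).
  intros E. apply C1_nz. rewrite <- (Cinv_l _ N), E. ring.
Qed.

Lemma Z_ind_iff (P : Z -> Prop) :
  P 0%Z -> (forall k, P k <-> P (k + 1)%Z) -> forall k, P k.
Proof.
  intros H0 H. apply Z.peano_ind; [exact H0| |]; intros k Hk.
  - rewrite <- Z.add_1_r. now apply (proj1 (H k)).
  - apply (proj2 (H (Z.pred k))). now replace (Z.pred k + 1)%Z with k by lia.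
Qed.

Lemma powZ_mult (y z : C) k : y <> 0 -> z <> 0 -> powZ (y * z) k = powZ y k * powZ z k.
Proof.
  intros hy hz. assert (h := Cmult_neq_0 _ _ hy hz).
  revert k. apply Z_ind_iff; [simpl; ring|]. intros k.
  rewrite !powZ_succ by assumption. split; intros H.
  - rewrite H. ring.
  - apply Cmult_reg_l with (y * z); [exact h|].
    transitivity (powZ (y * z) k * (y * z)); [ring|]. rewrite H. ring.
Qed.

Lemma powZ_neg (z : C) n : powZ z (- Z.of_nat n) = / z ^ n.
Proof. destruct n as [|n]; [simpl; field|]. simpl. now rewrite SuccNat2Pos.id_succ. Qed.

Section Grid.
Context (q : R) (hq : (0 < q < 1)%R).

Lemma powerRZ_q_succ k : powerRZ q (k + 1) = (powerRZ q k * q)%R.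
Proof. rewrite powerRZ_add, powerRZ_1; [reflexivity|lra]. Qed.

Lemma powerRZ_q_neq_0 k : RtoC (powerRZ q k) <> 0.
Proof. intros H. apply RtoC_inj in H. apply (powerRZ_NOR q k); lra. Qed.

Lemma qgrid_succ (t : C) k : qgrid q t (k + 1) = qgrid q t k * q.
Proof. unfold qgrid. rewrite powerRZ_q_succ, RtoC_mult. ring. Qed.

Lemma qgrid_neq_0 (t : C) k : t <> 0 -> qgrid q t k <> 0.
Proof. intros ht. apply Cmult_neq_0; [exact ht|apply powerRZ_q_neq_0]. Qed.

Lemma qgrid_0 (t : C) : qgrid q t 0 = t.
Proof. unfold qgrid. simpl. ring. Qed.

Lemma qgrid_nat (t : C) n : qgrid q t (Z.of_nat n) = t * RtoC (q ^ n)%R.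
Proof. unfold qgrid. now rewrite <- pow_powerRZ. Qed.

Lemma qgrid_neg (t : C) n : qgrid q t (- Z.of_nat n) * RtoC (q ^ n)%R = t.
Proof.
  unfold qgrid. rewrite powerRZ_neg', <- pow_powerRZ.
  rewrite RtoC_inv by (apply pow_nonzero; lra).
  field. now apply qpow_neq_0.
Qed.

Lemma qgrid_lim_0 (t c : C) : Clim (fun n => c * qgrid q t (Z.of_nat n)) 0.
Proof.
  apply is_lim_seq_ext with (fun n => Cmod (c * t) * q ^ n)%R.
  - intros n. rewrite qgrid_nat.
    replace (c * (t * RtoC (q ^ n)%R) - 0) with (c * t * RtoC (q ^ n)%R) by ring.
    now rewrite (Cmod_mult (c * t)), Cmod_qpow.
  - replace 0%R with (Cmod (c * t) * 0)%R by ring.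
    apply (is_lim_seq_scal_l _ _ 0%R). now apply qpow_lim0.
Qed.

Lemma qgrid_inv_lim_0 (t : C) :
  t <> 0 -> Clim (fun n => / qgrid q t (- Z.of_nat n)) 0.
Proof.
  intros ht. apply Clim_ext with (fun n => / t * qgrid q 1 (Z.of_nat n)).
  - intros n. rewrite qgrid_nat. rewrite <- (qgrid_neg t n) at 1.
    assert (H := qpow_neq_0 q hq n). assert (H' := qgrid_neq_0 t (- Z.of_nat n) ht).
    field; auto.
  - apply qgrid_lim_0.
Qed.

(** [ell p t k] is [p^k q^(k^2) t^(2k+1)]. If [F(x) = p x^2 F(qx)], then
    [F(t) x = ell p t k * F(x)] for [x = t q^k] (see [theta_pair_grid]). *)
Definition ell (p t : C) (k : Z) : C :=
  powZ (p * t * t) k * RtoC (powerRZ q (k * k)) * t.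

Lemma ell_succ (p t : C) k :
  p <> 0 -> t <> 0 ->
  ell p t (k + 1) = ell p t k * (p * q * qgrid q t k * qgrid q t k).
Proof.
  intros hp ht. unfold ell, qgrid.
  rewrite powZ_succ by (repeat apply Cmult_neq_0; assumption).
  replace ((k + 1) * (k + 1))%Z with (k * k + (k + (k + 1)))%Z by ring.
  rewrite !powerRZ_add by lra. rewrite powerRZ_1, !RtoC_mult. ring.
Qed.

Lemma ell_0 (p t : C) : ell p t 0 = t.
Proof. unfold ell. simpl. ring. Qed.

(** With [c = q] this is the weight times [theta(-ax) theta(-bx)], and has no
    denominators; with [c = b] it is a summand of a telescoping series. *)
Definition triple_inf (a b c x : C) : C :=
  qpoch_inf q (- c * x) * qpoch_inf q (- (q / (a * x))) * qpoch_inf q (- (q / (b * x))).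

(** A truncation that is a Laurent polynomial in [x]. *)
Definition triple_fin (N : nat) (a b c x : C) : C :=
  qpoch q (- c * x) N * qpoch q (- (q / (a * x))) N * qpoch q (- (q / (b * x))) N.

(** Bounds the terms with [triple_inf] and, uniformly in [N], those with
    [triple_fin N]. *)
Definition majorant (a b c t : C) (k : Z) : R :=
  let x := Cmod (qgrid q t k) in
  (Cmod (ell (a * b) t k) * rpoch_inf q (Cmod c * x)
   * rpoch_inf q (q / (Cmod a * x)) * rpoch_inf q (q / (Cmod b * x)))%R.

Lemma majorant_pos (a b c t : C) k : (0 <= majorant a b c t k)%R.
Proof. unfold majorant, rpoch_inf. repeat apply Rmult_le_pos; apply Cmod_ge_0. Qed.

(** The recurrence behind the ratio tests at both ends of the grid. *)
Lemma majorant_succ (a b c t : C) k :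
  a <> 0 -> b <> 0 -> t <> 0 ->
  let x := Cmod (qgrid q t k) in
  (majorant a b c t (k + 1) * (1 + Cmod c * x)
   = majorant a b c t k * (q * (1 + Cmod a * x) * (1 + Cmod b * x)))%R.
Proof.
  intros ha hb ht x. unfold majorant. rewrite qgrid_succ.
  rewrite ell_succ by auto using Cmult_neq_0.
  rewrite !Cmod_mult. fold x.
  replace (Cmod q) with q by (rewrite Cmod_R, Rabs_pos_eq; lra).
  assert (hx := proj1 (Cmod_gt_0 _) (qgrid_neq_0 t k ht)). fold x in hx.
  apply Cmod_gt_0 in ha, hb. assert (hc := Cmod_ge_0 c).
  assert (S : forall A, (0 < A)%R ->
     rpoch_inf q (q / (A * (x * q))) = ((1 + / (A * x)) * rpoch_inf q (q / (A * x)))%R).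
  { intros A hA.
    replace (q / (A * (x * q)))%R with (/ (A * x))%R by (field; lra).
    apply rpoch_inf_step; [exact hq| |field; lra].
    left. apply Rinv_0_lt_compat. now apply Rmult_lt_0_compat. }
  rewrite !S by assumption.
  rewrite (rpoch_inf_step q hq (Cmod c * x) (Cmod c * (x * q)));
    [|apply Rmult_le_pos; lra|ring].
  field. lra.
Qed.

(** Ratio test. Towards [x = 0] the ratio of consecutive terms tends to [q]; towards
    infinity the two factors [1 + Ax], [1 + Bx] beat [1 + Cx] and the ratio tends to
    zero. *)
Lemma majorant_summable (a b c t : C) :
  a <> 0 -> b <> 0 -> t <> 0 -> ex_seriesZ (majorant a b c t).
Proof.
  intros ha hb ht.
  assert (P : forall k, (0 <= majorant a b c t k)%R) by (intros; apply majorant_pos).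
  assert (St := fun k => majorant_succ a b c t k ha hb ht). cbv zeta in St.
  apply Cmod_gt_0 in ha, hb. assert (ht' := proj1 (Cmod_gt_0 t) ht).
  assert (hc := Cmod_ge_0 c).
  set (A := Cmod a) in *. set (B := Cmod b) in *. set (Cc := Cmod c) in *.
  split.
  - assert (L : is_lim_seq (fun n => q * (1 + A * Cmod (qgrid q t (Z.of_nat n)))
                                     * (1 + B * Cmod (qgrid q t (Z.of_nat n))))%R q).
    { assert (L0 : is_lim_seq (fun n => Cmod (qgrid q t (Z.of_nat n))) 0).
      { apply is_lim_seq_ext with (2 := qgrid_lim_0 t 1). intros n. f_equal; ring. }
      replace (Finite q) with (Finite (q * (1 + A * 0) * (1 + B * 0))) by (f_equal; ring).
      assert (L1 : forall D, is_lim_seq (fun n => 1 + D * Cmod (qgrid q t (Z.of_nat n)))%R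
                               (1 + D * 0)%R).
      { intros D. apply is_lim_seq_plus'; [apply is_lim_seq_const|].
        now apply (is_lim_seq_scal_l _ _ 0%R). }
      apply is_lim_seq_mult'; [|apply L1].
      apply is_lim_seq_mult'; [apply is_lim_seq_const|apply L1]. }
    assert (he : (0 < (1 - q) / 2)%R) by lra.
    destruct (proj2 (is_lim_seq_spec _ _) L (mkposreal _ he)) as [N HN].
    apply ex_series_ratio with ((1 + q) / 2)%R N; [intros; apply P|lra|].
    intros n hn. specialize (HN n hn). simpl pos in HN. apply Rabs_def2 in HN.
    specialize (St (Z.of_nat n)). replace (Z.of_nat (S n)) with (Z.of_nat n + 1)%Z by lia.
    set (x := Cmod (qgrid q t (Z.of_nat n))) in *.
    assert (hx : (0 <= x)%R) by apply Cmod_ge_0.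
    assert (P1 := P (Z.of_nat n)). assert (P2 := P (Z.of_nat n + 1)%Z).
    apply Rle_trans with (majorant a b c t (Z.of_nat n + 1) * (1 + Cc * x))%R.
    + assert (0 <= Cc * x)%R by (apply Rmult_le_pos; assumption). nra.
    + rewrite St. rewrite Rmult_comm. apply Rmult_le_compat_r; [exact P1|lra].
  - (* [M] is chosen so that [x > M] forces [(1 + C) x <= q A B x^2 / 2]. *)
    set (M := (1 + 2 * (1 + Cc) / (q * A * B))%R).
    assert (hqAB : (0 < q * A * B)%R) by (repeat apply Rmult_lt_0_compat; lra).
    assert (hM : (1 <= M)%R).
    { unfold M. assert (0 <= 2 * (1 + Cc) / (q * A * B))%R; [|lra].
      apply Rmult_le_pos; [lra|left; now apply Rinv_0_lt_compat]. }
    assert (he : (0 < / M)%R) by (apply Rinv_0_lt_compat; lra).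
    destruct (proj2 (is_lim_seq_spec _ _) (qgrid_inv_lim_0 t ht) (mkposreal _ he)) as [N HN].
    apply ex_series_ratio with (/ 2)%R N; [intros; apply P|lra|].
    intros n hn. assert (hn' : (N <= S (S n))%nat) by lia.
    specialize (HN _ hn'). simpl pos in HN.
    rewrite Rminus_0_r, Rabs_pos_eq in HN by apply Cmod_ge_0.
    replace (/ qgrid q t (- Z.of_nat (S (S n))) - 0)
      with (/ qgrid q t (- Z.of_nat (S (S n)))) in HN by ring.
    assert (hx0 := qgrid_neq_0 t (- Z.of_nat (S (S n))) ht).
    rewrite Cmod_inv in HN by exact hx0.
    specialize (St (- Z.of_nat (S (S n)))%Z).
    replace (- Z.of_nat (S (S n)) + 1)%Z with (- Z.of_nat (S n))%Z in St by lia.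
    apply Cmod_gt_0 in hx0.
    set (x := Cmod (qgrid q t (- Z.of_nat (S (S n))))) in *.
    assert (P1 := P (- Z.of_nat (S n))%Z). assert (P2 := P (- Z.of_nat (S (S n)))%Z).
    assert (hx : (M < x)%R).
    { apply Rinv_lt_cancel; [exact hx0|exact HN]. }
    assert (hx1 : (1 < x)%R) by lra.
    assert (K1 : (1 + Cc * x <= (1 + Cc) * x)%R) by nra.
    assert (K2 : ((1 + Cc) <= / 2 * (q * A * B) * x)%R).
    { assert (h : (2 * (1 + Cc) / (q * A * B) <= x)%R) by (unfold M in hx; lra).
      apply (Rmult_le_compat_l (q * A * B)) in h; [|lra].
      replace (q * A * B * (2 * (1 + Cc) / (q * A * B)))%R with (2 * (1 + Cc))%R in h
        by (field; lra). lra. }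
    assert (K3 : ((1 + Cc) * x <= / 2 * (q * (1 + A * x) * (1 + B * x)))%R).
    { apply Rle_trans with (/ 2 * (q * A * B) * x * x)%R; [nra|].
      assert (0 <= q * A * x)%R by (repeat apply Rmult_le_pos; lra).
      assert (0 <= q * B * x)%R by (repeat apply Rmult_le_pos; lra). nra. }
    set (K := (q * (1 + A * x) * (1 + B * x))%R) in *.
    assert (hK : (0 < K)%R).
    { unfold K. repeat apply Rmult_lt_0_compat; nra. }
    apply Rmult_le_reg_r with K; [exact hK|]. rewrite <- St.
    replace (/ 2 * majorant a b c t (- Z.of_nat (S n)) * K)%R
      with (majorant a b c t (- Z.of_nat (S n)) * (/ 2 * K))%R by ring.
    apply Rmult_le_compat_l; [exact P1|lra].
Qed.

Lemma Cmod_q_div (a x : C) : a <> 0 -> x <> 0 ->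
  Cmod (- (q / (a * x))) = (q / (Cmod a * Cmod x))%R.
Proof.
  intros ha hx. rewrite Cmod_opp, Cmod_div, Cmod_mult by auto using Cmult_neq_0.
  now rewrite Cmod_R, Rabs_pos_eq by lra.
Qed.

Lemma Cmod_opp_mult (c x : C) : Cmod (- c * x) = (Cmod c * Cmod x)%R.
Proof. now rewrite Cmod_mult, Cmod_opp. Qed.

Lemma triple_fin_majorant N (a b c t : C) k : a <> 0 -> b <> 0 -> t <> 0 ->
  (Cmod (ell (a * b) t k * triple_fin N a b c (qgrid q t k)) <= majorant a b c t k)%R.
Proof.
  intros ha hb ht. assert (hx := qgrid_neq_0 t k ht).
  unfold triple_fin, majorant. rewrite !Cmod_mult, !Rmult_assoc.
  apply Rmult_le_compat_l; [apply Cmod_ge_0|].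
  repeat apply Rmult_le_compat;
    repeat apply Rmult_le_pos; try apply Cmod_ge_0; apply Cmod_qpoch_le_inf; auto.
  - right. apply Cmod_opp_mult.
  - right. now apply Cmod_q_div.
  - right. now apply Cmod_q_div.
Qed.

Lemma triple_fin_lim (a b c x : C) : Clim (fun N => triple_fin N a b c x)
    (triple_inf a b c x).
Proof. repeat apply Clim_mult; now apply qpoch_lim. Qed.

Definition theta_sum (a b c t : C) : C :=
  CSeriesZ (fun k => ell (a * b) t k * triple_inf a b c (qgrid q t k)).

(** Tannery applied to the truncations [triple_fin N]. *)
Lemma theta_sum_lim (a b c t : C) : a <> 0 -> b <> 0 -> t <> 0 ->
  Clim (fun N => CSeriesZ (fun k => ell (a * b) t k * triple_fin N a b c (qgrid q t k)))
       (theta_sum a b c t)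
  /\ abs_summableZ (fun k => ell (a * b) t k * triple_inf a b c (qgrid q t k)).
Proof.
  intros ha hb ht.
  apply (CSeriesZ_tannery
           (fun N k => ell (a * b) t k * triple_fin N a b c (qgrid q t k))
           (fun k => ell (a * b) t k * triple_inf a b c (qgrid q t k)) (majorant a b c t)).
  - intros; now apply triple_fin_majorant.
  - now apply majorant_summable.
  - intros k. apply Clim_scal, triple_fin_lim.
Qed.

(** * The two-dimensional space of theta functions of degree two *)

Definition mono (p t : C) (d k : Z) : C := ell p t k * powZ (qgrid q t k) d.

(** The two series [Theta p 0] and [Theta p 1] span the space of theta functions with
    [F(x) = p x^2 F(qx)]. *)
Definition Theta (p : C) (d : Z) (t : C) : C := CSeriesZ (mono p t d).

(** The coefficients do not depend on [t]. Summability is included, since [CSeriesZ]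
    is linear only on summable series. *)
Definition in_span (p : C) (u : C -> Z -> C) : Prop :=
  exists c e : C, forall t : C, t <> 0 ->
    abs_summableZ (u t) /\ CSeriesZ (u t) = c * Theta p 0 t + e * Theta p 1 t.

Lemma in_span_lin p (u v : C -> Z -> C) (g h : C) :
  in_span p u -> in_span p v -> in_span p (fun t k => g * u t k + h * v t k).
Proof.
  intros [c [e H]] [c' [e' H']]. exists (g * c + h * c'), (g * e + h * e').
  intros t ht. destruct (H t ht) as [S1 E1]. destruct (H' t ht) as [S2 E2].
  assert (S1' := abs_summableZ_scal g _ S1). assert (S2' := abs_summableZ_scal h _ S2).
  split; [now apply abs_summableZ_plus|].
  rewrite (CSeriesZ_plus (fun k => g * u t k)) by assumption.
  rewrite !CSeriesZ_scal, E1, E2 by assumption. ring.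
Qed.

Lemma in_span_ext p (u v : C -> Z -> C) :
  (forall (t : C) k, t <> 0 -> u t k = v t k) -> in_span p u -> in_span p v.
Proof.
  intros E [c [e H]]. exists c, e. intros t ht. destruct (H t ht) as [S1 E1].
  split.
  - revert S1. apply abs_summableZ_ext. intros k; now apply E.
  - rewrite <- E1. apply CSeriesZ_ext. intros k; symmetry; now apply E.
Qed.

(** Shifting the summation index by one multiplies the summand by [x^2] up to a
    constant. *)
Lemma mono_shift (p t : C) d k : p <> 0 -> t <> 0 ->
  mono p t d (k + 1) = p * q * powZ q d * mono p t (d + 1 + 1) k.
Proof.
  intros hp ht. unfold mono.
  assert (hx := qgrid_neq_0 t k ht). assert (hq0 := q_neq_0 q hq).
  rewrite ell_succ, qgrid_succ by assumption.
  rewrite !powZ_succ by assumption.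
  assert (M : powZ (qgrid q t k * q) d = powZ (qgrid q t k) d * powZ q d).
  { assert (hm := Cmult_neq_0 _ _ hx hq0). clear - hx hq0 hm.
    revert d. apply Z.peano_ind.
    - simpl; ring.
    - intros d IH. rewrite <- Z.add_1_r, !powZ_succ, IH by assumption. ring.
    - intros d IH. replace d with (Z.pred d + 1)%Z in IH by lia.
      rewrite !powZ_succ in IH by assumption.
      assert (E : (powZ (qgrid q t k * q) (Z.pred d)
                   - powZ (qgrid q t k) (Z.pred d) * powZ q (Z.pred d))
                  * (qgrid q t k * q) = 0).
      { transitivity (powZ (qgrid q t k * q) (Z.pred d) * (qgrid q t k * q)
          - powZ (qgrid q t k) (Z.pred d) * qgrid q t k * (powZ q (Z.pred d) * q)); [ring|].
        rewrite IH. ring. }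
      apply Ceq_minus. apply NNPP. intros N. now apply (Cmult_neq_0 _ _ N hm). }
  rewrite M. ring.
Qed.

(** By [mono_shift] the degree can be moved by two in either direction, down to one of
    the degrees [0] and [1]. *)
Lemma in_span_mono (p : C) d : p <> 0 -> in_span p (fun t => mono p t d).
Proof.
  intros hp. assert (hq0 := q_neq_0 q hq).
  assert (S : forall d', (d' = 0 \/ d' = 1)%Z ->
            forall t : C, t <> 0 -> abs_summableZ (mono p t d')).
  { intros d' hd t ht. assert (h1 := C1_nz).
    apply abs_summableZ_le with (majorant p 1 1 t);
        [|exact (majorant_summable p 1 1 t hp h1 ht)].
    intros k. unfold mono, majorant. rewrite Cmult_1_r, Cmod_mult, Cmod_1, !Rmult_assoc.
    apply Rmult_le_compat_l; [apply Cmod_ge_0|].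
    assert (hx := proj1 (Cmod_gt_0 _) (qgrid_neq_0 t k ht)).
    set (x := Cmod (qgrid q t k)) in *. rewrite !Rmult_1_l.
    assert (G : forall r, (0 < r)%R -> (1 <= rpoch_inf q r)%R)
      by (intros; apply rpoch_inf_ge1; [exact hq|lra]).
    apply Cmod_gt_0 in hp.
    assert (G1 : (1 <= rpoch_inf q (q / (Cmod p * x)))%R).
    { apply G, Rdiv_lt_0_compat; [lra|now apply Rmult_lt_0_compat]. }
    assert (G2 : (1 <= rpoch_inf q (q / x))%R) by (apply G, Rdiv_lt_0_compat; lra).
    assert (G3 : (1 + x <= rpoch_inf q x)%R).
    { replace (1 + x)%R with (rpoch q x 1) by (simpl; ring).
      apply rpoch_le_inf; [exact hq|lra]. }
    assert (G4 : (Cmod (powZ (qgrid q t k) d') <= 1 + x)%R).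
    { destruct hd as [->| ->]; simpl.
      - rewrite Cmod_1; lra.
      - rewrite Cmult_1_r. fold x; lra. }
    assert (G5 : (1 <= rpoch_inf q (q / (Cmod p * x)) * rpoch_inf q (q / x))%R) by nra.
    nra. }
  assert (St : forall d, in_span p (fun t => mono p t d)
                         <-> in_span p (fun t => mono p t (d + 1 + 1))).
  { intros d'. assert (hk : p * q * powZ q d' <> 0)
      by (apply Cmult_neq_0; [now apply Cmult_neq_0|now apply powZ_neq_0]).
    split; intros [c [e H]].
    - exists (c / (p * q * powZ q d')), (e / (p * q * powZ q d')).
      intros t ht. destruct (H t ht) as [S1 E1].
      assert (S2 := abs_summableZ_shift _ S1). assert (E2 := CSeriesZ_shift _ S1).
      assert (X : forall k, / (p * q * powZ q d') * mono p t d' (k + 1)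
                            = mono p t (d' + 1 + 1) k).
      { intros k. rewrite mono_shift by assumption.
        set (K := p * q * powZ q d') in *. field; auto. }
      split.
      + apply abs_summableZ_ext with (1 := X). now apply abs_summableZ_scal.
      + rewrite <- (CSeriesZ_ext _ _ X), CSeriesZ_scal by assumption.
        rewrite E2, E1. set (K := p * q * powZ q d') in *. field; auto.
    - exists ((p * q * powZ q d') * c), ((p * q * powZ q d') * e).
      intros t ht. destruct (H t ht) as [S1 E1].
      assert (X : forall k, (p * q * powZ q d') * mono p t (d' + 1 + 1) k
                            = mono p t d' (k + 1))
        by (intros k; now rewrite mono_shift).
      assert (S2 : abs_summableZ (mono p t d')).
      { apply abs_summableZ_unshift. apply abs_summableZ_ext with (1 := X).
        now apply abs_summableZ_scal. }
      split; [exact S2|].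
      rewrite <- (CSeriesZ_shift _ S2), <- (CSeriesZ_ext _ _ X), CSeriesZ_scal, E1
        by assumption. ring. }
  (* The degrees are treated in consecutive pairs because [St] moves by two. *)
  enough (W : forall d, in_span p (fun t => mono p t d)
                        /\ in_span p (fun t => mono p t (d + 1))) by apply W.
  apply Z.peano_ind.
  - split.
    + exists 1, 0. intros t ht. split; [apply S; auto|].
      unfold Theta. ring.
    + exists 0, 1. intros t ht. split; [apply (S 1%Z); auto|].
      unfold Theta. simpl. ring.
  - intros d' [H1 H2]. rewrite <- Z.add_1_r. split; [exact H2|now apply (proj1 (St d'))].
  - intros d' [H1 H2]. replace d' with (Z.pred d' + 1)%Z in H1, H2 by lia.
    split; [apply (proj2 (St (Z.pred d'))); exact H2|exact H1].
Qed.

(** All degrees [d] are required at once, so that the property is stable under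
    multiplication by [1 + g x] and by [1 + g / x]. *)
Definition laurent_like (p : C) (g : C -> C) : Prop :=
  forall d, in_span p (fun t k => mono p t d k * g (qgrid q t k)).

Lemma laurent_like_qpoch_pos (p : C) g (c : C) N :
  laurent_like p g -> laurent_like p (fun x => qpoch q (- c * x) N * g x).
Proof.
  intros Hg. induction N as [|N IH]; intros d.
  - apply in_span_ext with (2 := Hg d). intros t k ht. simpl. ring.
  - apply in_span_ext with (2 := in_span_lin _ _ _ 1 (c * RtoC (q ^ N)%R)
                                  (IH d) (IH (d + 1)%Z)).
    intros t k ht. cbn [qpoch]. unfold mono.
    rewrite powZ_succ by now apply qgrid_neq_0. ring.
Qed.

Lemma laurent_like_qpoch_neg (p : C) g (a : C) N : a <> 0 ->
  laurent_like p g -> laurent_like p (fun x => qpoch q (- (q / (a * x))) N * g x).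
Proof.
  intros ha Hg. induction N as [|N IH]; intros d.
  - apply in_span_ext with (2 := Hg d). intros t k ht. simpl. ring.
  - apply in_span_ext with (2 := in_span_lin _ _ _ 1 (q / a * RtoC (q ^ N)%R)
                                  (IH d) (IH (d - 1)%Z)).
    intros t k ht. cbn [qpoch]. unfold mono.
    replace d with (d - 1 + 1)%Z at 1 3 by lia.
    assert (hx := qgrid_neq_0 t k ht).
    rewrite powZ_succ by assumption. field; auto.
Qed.

Lemma in_span_triple_fin N (a b c : C) : a <> 0 -> b <> 0 ->
  in_span (a * b) (fun t k => ell (a * b) t k * triple_fin N a b c (qgrid q t k)).
Proof.
  intros ha hb.
  assert (L : laurent_like (a * b) (fun x => qpoch q (- c * x) N *
     (qpoch q (- (q / (a * x))) N * (qpoch q (- (q / (b * x))) N * 1)))).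
  { apply laurent_like_qpoch_pos.
    apply (laurent_like_qpoch_neg _ _ a N ha).
    apply (laurent_like_qpoch_neg _ (fun _ => 1) b N hb).
    intros d. apply in_span_ext with (2 := in_span_mono (a * b) d (Cmult_neq_0 _ _ ha hb)).
    intros; ring. }
  apply in_span_ext with (2 := L 0%Z). intros t k ht.
  unfold mono, triple_fin. simpl powZ. ring.
Qed.

(** Pointwise limits suffice: the vanishing of 3x3 determinants passes to the limit, so
    the coefficients need not be shown to converge. *)
Definition in_closure (p : C) (F : C -> C) : Prop :=
  exists G : nat -> C -> C,
    (forall N, exists c e, forall t : C, t <> 0 -> G N t = c * Theta p 0 t + e * Theta p 1 t)
    /\ (forall t : C, t <> 0 -> Clim (fun N => G N t) (F t)).

Lemma in_closure_theta_sum (a b c : C) : a <> 0 -> b <> 0 -> in_closure (a * b)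
    (theta_sum a b c).
Proof.
  intros ha hb.
  exists (fun N t => CSeriesZ (fun k => ell (a * b) t k * triple_fin N a b c (qgrid q t k))).
  split.
  - intros N. destruct (in_span_triple_fin N a b c ha hb) as [c' [e H]].
    exists c', e. intros t ht. now apply H.
  - intros t ht. now apply theta_sum_lim.
Qed.

Lemma in_closure_scal (p g : C) F G :
  (forall t : C, t <> 0 -> G t = g * F t) -> in_closure p F -> in_closure p G.
Proof.
  intros E [H [H1 H2]]. exists (fun N t => g * H N t). split.
  - intros N. destruct (H1 N) as [c [e hce]]. exists (g * c), (g * e).
    intros t ht. rewrite hce by assumption. ring.
  - intros t ht. rewrite E by assumption. now apply Clim_scal, H2.
Qed.

Definition det3 (F G H : C -> C) (r s t : C) : C :=
  F r * (G s * H t - G t * H s) - G r * (F s * H t - F t * H s)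
  + H r * (F s * G t - F t * G s).

(** Three elements of a two-dimensional space are linearly dependent. *)
Lemma in_closure_det3 (p : C) F G H (r s t : C) :
  in_closure p F -> in_closure p G -> in_closure p H ->
  r <> 0 -> s <> 0 -> t <> 0 -> det3 F G H r s t = 0.
Proof.
  intros [F' [F1 F2]] [G' [G1 G2]] [H' [H1 H2]] hr hs ht.
  apply Clim_unique with (fun N => det3 (F' N) (G' N) (H' N) r s t).
  - unfold det3. repeat first [apply Clim_minus|apply Clim_plus|apply Clim_mult]; auto.
  - apply Clim_ext with (fun _ => 0); [|apply Clim_const].
    intros N. destruct (F1 N) as [c [e E1]]. destruct (G1 N) as [c' [e' E2]].
    destruct (H1 N) as [c'' [e'' E3]].
    unfold det3. rewrite !E1, !E2, !E3 by assumption. ring.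
Qed.

End Grid.

(** * Products of two theta functions *)

Section ThetaProducts.
Context (q : R) (hq : (0 < q < 1)%R).

Definition theta_pair (a b t : C) : C := theta q (- a * t) * theta q (- b * t).

Lemma theta_pair_step (a b x : C) : a <> 0 -> b <> 0 -> x <> 0 ->
  theta_pair a b x = a * b * x * x * theta_pair a b (x * q).
Proof.
  intros ha hb hx. unfold theta_pair.
  assert (N : forall c : C, c <> 0 -> - c * x <> 0).
  { intros c hc. apply Cmult_neq_0; [|exact hx]. intros E. apply hc.
    replace c with (- - c) by ring. rewrite E. ring. }
  rewrite (theta_step q hq (- a * x) (- a * (x * q))) by (auto; ring).
  rewrite (theta_step q hq (- b * x) (- b * (x * q))) by (auto; ring).
  ring.
Qed.

Lemma theta_pair_grid (a b t : C) k : a <> 0 -> b <> 0 -> t <> 0 ->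
  theta_pair a b t * qgrid q t k = ell q (a * b) t k * theta_pair a b (qgrid q t k).
Proof.
  intros ha hb ht. assert (hq0 := q_neq_0 q hq). revert k. apply Z_ind_iff.
  - rewrite qgrid_0, ell_0. ring.
  - intros k. assert (hx := qgrid_neq_0 q hq t k ht).
    rewrite qgrid_succ, ell_succ by auto using Cmult_neq_0.
    rewrite (theta_pair_step a b (qgrid q t k)) by assumption. split; intros H.
    + transitivity (q * (theta_pair a b t * qgrid q t k)); [ring|]. rewrite H. ring.
    + apply Cmult_reg_l with (RtoC q); [exact hq0|].
      transitivity (theta_pair a b t * (qgrid q t k * q)); [ring|]. rewrite H. ring.
Qed.

Lemma q_div_opp (b x : C) : b <> 0 -> x <> 0 -> q / (- b * x) = - (q / (b * x)).
Proof.
  intros hb hx. assert (- b <> 0).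
  { intros E. apply hb. replace b with (- - b) by ring. rewrite E. ring. }
  field; auto.
Qed.

(** With [(-bx;q)_oo] as first factor, the summand divided by [V(t)], where [V] is the
    theta pair, is [x/(-ax;q)_oo], a difference of [1/(-ax;q)_oo] at consecutive grid
    points up to the factor [a]. The proof multiplies this through by [V(t)], so that
    zeros of [V] cause no trouble. *)
Lemma theta_sum_telescoping (a b t : C) : a <> 0 -> b <> 0 -> t <> 0 ->
  a * theta_sum q a b b t = theta_pair a b t.
Proof.
  intros ha hb ht. assert (hq0 := q_neq_0 q hq).
  assert (hx := fun k => qgrid_neq_0 q hq t k ht).
  destruct (theta_sum_lim q hq a b b t ha hb ht) as [_ Su].
  set (g := fun k => ell q (a * b) t k * / qgrid q t k
        * (theta q (- b * qgrid q t k) * qpoch_inf q (- (q / (a * qgrid q t k))))).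
  assert (T := CSeriesZ_telescope g (theta_pair a b t) 0).
  rewrite (CSeriesZ_ext _ (fun k =>
      (- a) * (ell q (a * b) t k * triple_inf q a b b (qgrid q t k)))) in T.
  - rewrite CSeriesZ_scal in T by exact Su. unfold theta_sum.
    apply Cmult_reg_l with (RtoC (-1)).
    + intros E. apply RtoC_inj in E. lra.
    + transitivity (- a * CSeriesZ (fun k => ell q (a * b) t k * triple_inf q a b b
          (qgrid q t k))).
      * ring.
      * rewrite T; [ring| |].
        -- apply Clim_div_1 with (fun n => qpoch_inf q (- a * qgrid q t (Z.of_nat n)))
             (fun _ => theta_pair a b t); [|apply qpoch_inf_near0, qgrid_lim_0;
                 exact hq|apply Clim_const].
           intros n. unfold g. specialize (hx (Z.of_nat n)).
           transitivity (/ qgrid q t (Z.of_nat n)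
               * (ell q (a * b) t (Z.of_nat n) * theta_pair a b (qgrid q t (Z.of_nat n)))).
           ++ unfold theta_pair, theta. rewrite (q_div_opp a) by assumption. ring.
           ++ rewrite <- theta_pair_grid by assumption. field; auto.
        -- apply Clim_ext with (fun n =>
             (ell q (a * b) t (- Z.of_nat n) * triple_inf q a b b (qgrid q t (- Z.of_nat n)))
             * / qgrid q t (- Z.of_nat n)).
           ++ intros n. unfold g, triple_inf, theta. rewrite (q_div_opp b) by auto. ring.
           ++ replace (RtoC 0) with (0 * 0) by ring.
              apply Clim_mult; [exact (abs_summableZ_lim_neg _ Su)|].
              now apply qgrid_inv_lim_0.
  - intros k. unfold g, triple_inf. specialize (hx k).
    rewrite qgrid_succ, ell_succ by auto using Cmult_neq_0.
    set (x := qgrid q t k) in *.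
    assert (hbx : - b * x <> 0).
    { apply Cmult_neq_0; [|exact hx]. intros E. apply hb.
      replace b with (- - b) by ring. rewrite E. ring. }
    rewrite (qpoch_inf_step q hq (- (q / (a * (x * q)))) (- (q / (a * x))))
      by (field; auto).
    transitivity (ell q (a * b) t k * / x *
        (theta q (- b * x) * qpoch_inf q (- (q / (a * x))))
       - ell q (a * b) t k * (a * (1 + / (a * x))) * (b * x * theta q (- b * (x * q))) *
             qpoch_inf q (- (q / (a * x)))).
    { field; auto. }
    replace (b * x * theta q (- b * (x * q))) with (theta q (- b * x)).
    + unfold theta. rewrite (q_div_opp b) by auto. field; auto.
    + rewrite (theta_step q hq (- b * x) (- b * (x * q))) by (auto; ring). ring.
Qed.

(** This replaces the Jacobi triple product: it places [theta(-at) theta(-bt)] in the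
    two-dimensional space without expanding it in powers of [t]. *)
Lemma in_closure_theta_pair (a b : C) : a <> 0 -> b <> 0 -> in_closure q (a * b)
    (theta_pair a b).
Proof.
  intros ha hb.
  apply in_closure_scal with a (theta_sum q a b b); [|now apply in_closure_theta_sum].
  intros t ht. symmetry. now apply theta_sum_telescoping.
Qed.

Lemma ell_scale (p c t : C) k : p <> 0 -> c <> 0 -> t <> 0 ->
  ell q (p * c) t k = ell q p t k * powZ c k.
Proof.
  intros hp hc ht. unfold ell.
  replace (p * c * t * t) with (p * t * t * c) by ring.
  rewrite powZ_mult by (repeat apply Cmult_neq_0; assumption). ring.
Qed.

Lemma powZ_q k : powZ q k = RtoC (powerRZ q k).
Proof.
  assert (hq0 := q_neq_0 q hq). revert k. apply Z_ind_iff; [reflexivity|].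
  intros k. rewrite powZ_succ, powerRZ_q_succ, RtoC_mult by assumption.
  split; intros H; [now rewrite H|].
  apply Cmult_reg_l with (RtoC q); [exact hq0|]. rewrite !(Cmult_comm q). exact H.
Qed.

(** The contiguous relation [(1 - b) S(a,b) - a S(a,bq) = -1] between the weight sums,
    multiplied by the theta pair, so that it holds for every nonzero [t], zeros of the
    theta pair included. The summand is the difference of [(1 + x) w(x)] at consecutive
    grid points. *)
Lemma theta_sum_recurrence (a b t : C) : a <> 0 -> b <> 0 -> t <> 0 ->
  (1 - b) * theta_sum q a b q t - a * b * t * theta_sum q a (b * q) q t = - theta_pair a b t.
Proof.
  intros ha hb ht. assert (hq0 := q_neq_0 q hq).
  assert (hx := fun k => qgrid_neq_0 q hq t k ht).
  destruct (theta_sum_lim q hq a b q t ha hb ht) as [_ Su].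
  destruct (theta_sum_lim q hq a (b * q) q t ha (Cmult_neq_0 _ _ hb hq0) ht) as [_ Su'].
  set (g := fun k => ell q (a * b) t k * triple_inf q a b q
      (qgrid q t k) * (1 + / qgrid q t k)).
  assert (T := CSeriesZ_telescope g (theta_pair a b t) 0).
  rewrite (CSeriesZ_ext _ (fun k =>
      (1 - b) * (ell q (a * b) t k * triple_inf q a b q (qgrid q t k))
      + (- (a * b * t)) * (ell q (a * (b * q)) t k * triple_inf q a (b * q) q
            (qgrid q t k)))) in T.
  - rewrite (CSeriesZ_plus (fun k =>
        (1 - b) * (ell q (a * b) t k * triple_inf q a b q (qgrid q t k))))
      in T by (now apply abs_summableZ_scal).
    rewrite !CSeriesZ_scal in T by assumption. unfold theta_sum.
    transitivity (0 - theta_pair a b t); [|ring]. rewrite <- T; [ring| |].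
    + apply Clim_div_1 with
        (fun n => qpoch_inf q (- a * qgrid q t (Z.of_nat n))
                  * qpoch_inf q (- b * qgrid q t (Z.of_nat n)))
        (fun n => theta_pair a b t * qpoch_inf q ((-1) * qgrid q t (Z.of_nat n))).
      * intros n. unfold g, triple_inf. specialize (hx (Z.of_nat n)).
        rewrite (qpoch_inf_step q hq (-1 * qgrid q t (Z.of_nat n))
            (- q * qgrid q t (Z.of_nat n)))
          by ring.
        set (x := qgrid q t (Z.of_nat n)) in *.
        transitivity (/ x * (ell q (a * b) t (Z.of_nat n) * theta_pair a b x) * (1 + x) *
            qpoch_inf q (- q * x)).
        -- unfold theta_pair, theta. rewrite (q_div_opp a), (q_div_opp b) by assumption.
           field; auto.
        -- unfold x. rewrite <- theta_pair_grid by assumption. fold x. field; auto.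
      * rewrite <- (Cmult_1_l 1).
        apply Clim_mult; apply qpoch_inf_near0; auto using qgrid_lim_0.
      * rewrite <- (Cmult_1_r (theta_pair a b t)) at 1.
        apply Clim_scal, qpoch_inf_near0; auto using qgrid_lim_0.
    + replace (RtoC 0) with (0 * (1 + 0)) by ring.
      apply Clim_mult; [exact (abs_summableZ_lim_neg _ Su)|].
      apply Clim_plus; [apply Clim_const|now apply qgrid_inv_lim_0].
  - intros k. unfold g, triple_inf. specialize (hx k).
    replace (a * (b * q)) with (a * b * q) by ring.
    rewrite (ell_scale (a * b)), powZ_q by auto using Cmult_neq_0.
    assert (E : RtoC (powerRZ q k) = qgrid q t k / t) by (unfold qgrid; field; auto).
    rewrite E, qgrid_succ, ell_succ by auto using Cmult_neq_0.
    set (x := qgrid q t k) in *.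
    rewrite (qpoch_inf_step q hq (- (q / (a * (x * q)))) (- (q / (a * x)))) by (field; auto).
    rewrite (qpoch_inf_step q hq (- (q / (b * (x * q)))) (- (q / (b * x)))) by (field; auto).
    rewrite (qpoch_inf_step q hq (- (q / (b * q * x))) (- (q / (b * x)))) by (field; auto).
    rewrite (qpoch_inf_step q hq (- q * x) (- q * (x * q))) by ring.
    field; auto.
Qed.

Lemma theta_eq0_1 (x : C) : x = 1 -> theta q x = 0.
Proof. intros ->. now apply theta_1. Qed.

(** At [t = -1/a] the theta pair vanishes, and the recurrence becomes a two-term one. *)
Lemma theta_sum_at_zero_descent (a b : C) n : a <> 0 -> b <> 0 ->
  theta_sum q a b q (- / a)
  = qpoch q (q / b) n * theta_sum q a (b * / RtoC (q ^ n)%R) q (- / a).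
Proof.
  intros ha hb. assert (hq0 := q_neq_0 q hq).
  induction n as [|n IH].
  - simpl. replace (b * / 1) with b by (field; apply C1_nz). ring.
  - rewrite IH. simpl qpoch.
    assert (hn := qpow_neq_0 q hq n). assert (hn' := qpow_neq_0 q hq (S n)).
    assert (R := theta_sum_recurrence a (b * / RtoC (q ^ S n)%R) (- / a)).
    replace (b * / RtoC (q ^ S n)%R * q) with (b * / RtoC (q ^ n)%R) in R
      by (rewrite qpow_S; field; auto).
    assert (E : theta_pair a (b * / RtoC (q ^ S n)%R) (- / a) = 0).
    { unfold theta_pair. rewrite theta_eq0_1 by (field; auto). ring. }
    rewrite E in R.
    set (T1 := theta_sum q a (b * / RtoC (q ^ S n)%R) q (- / a)) in *.
    set (T0 := theta_sum q a (b * / RtoC (q ^ n)%R) q (- / a)) in *.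
    assert (R' : T0 = (1 - q / b * RtoC (q ^ n)%R) * T1).
    { apply Cmult_reg_l with (b * / RtoC (q ^ S n)%R).
      - auto using Cmult_neq_0, Cinv_neq_0.
      - apply Ceq_minus.
        transitivity ((1 - b * / RtoC (q ^ S n)%R) * T1
          - a * (b * / RtoC (q ^ S n)%R) * - / a * T0).
        + rewrite qpow_S. field; auto.
        + rewrite R; auto using Cmult_neq_0, Cinv_neq_0, Copp_neq_0. ring. }
    rewrite R'. ring.
Qed.

(** Let [n] tend to infinity in [theta_sum_at_zero_descent]. The terms with [k > 0]
    vanish because of the factor [(-q/(ax);q)_oo], those with [k < 0] carry a factor
    [q^(-kn)], and the term [k = 0] converges. *)
Lemma theta_sum_at_zero (a b : C) : a <> 0 -> b <> 0 ->
  theta_sum q a b q (- / a)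
  = - / a * (qpoch_inf q q * qpoch_inf q (q / a) * qpoch_inf q (q / b)).
Proof.
  intros ha hb. assert (hq0 := q_neq_0 q hq).
  set (t := - / a). assert (ht : t <> 0) by (unfold t; auto using Copp_neq_0, Cinv_neq_0).
  set (bn := fun n => b * / RtoC (q ^ n)%R).
  assert (hbn : forall n, bn n <> 0).
  { intros n. apply Cmult_neq_0; [exact hb|]. apply Cinv_neq_0. now apply qpow_neq_0. }
  (* The termwise limit: only [k = 0] survives. *)
  set (v := fun k : Z => if Z.eqb k 0
             then t * (qpoch_inf q (- q * t) * qpoch_inf q (- (q / (a * t))) * 1) else 0).
  assert (Z : forall n k, (0 < k)%Z ->
     ell q (a * bn n) t k * triple_inf q a (bn n) q (qgrid q t k) = 0).
  { intros n k hk. unfold triple_inf.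
    rewrite (qpoch_inf_zero q hq (- (q / (a * qgrid q t k))) (Z.to_nat (k - 1))); [ring|].
    replace k with (Z.of_nat (S (Z.to_nat (k - 1)))) at 1 by lia.
    rewrite qgrid_nat, qpow_S. assert (hn := qpow_neq_0 q hq (Z.to_nat (k - 1))).
    unfold t. field; auto. }
  assert (Y : forall n j, ell q (a * bn n) t (- Z.of_nat j)
       = ell q (a * b) t (- Z.of_nat j) * RtoC ((q ^ j) ^ n)%R).
  { intros n j. unfold bn. rewrite Cmult_assoc.
    assert (hn := qpow_neq_0 q hq n).
    rewrite ell_scale by auto using Cmult_neq_0, Cinv_neq_0.
    rewrite powZ_neg. f_equal.
    rewrite Cpow_inv by exact hn. rewrite <- RtoC_pow, <- !pow_mult, Nat.mul_comm.
    field. now apply qpow_neq_0. }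
  assert (B : forall n j,
     (Cmod (triple_inf q a (bn n) q (qgrid q t (- Z.of_nat j)) * ell q (a * b) t
         (- Z.of_nat j))
      <= majorant q a b q t (- Z.of_nat j))%R).
  { intros n j. set (x := qgrid q t (- Z.of_nat j)).
    assert (hx : x <> 0) by (now apply qgrid_neq_0).
    rewrite Cmult_comm. unfold triple_inf, majorant. fold x. rewrite !Cmod_mult, !Rmult_assoc.
    apply Rmult_le_compat_l; [apply Cmod_ge_0|].
    repeat apply Rmult_le_compat; repeat apply Rmult_le_pos; try apply Cmod_ge_0;
      apply Cmod_qpoch_inf_le; auto.
    - right. apply Cmod_opp_mult.
    - right. now apply Cmod_q_div.
    - rewrite Cmod_q_div by auto. unfold bn.
      rewrite Cmod_mult, Cmod_inv, Cmod_qpow by (auto; now apply qpow_neq_0).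
      apply Cmod_gt_0 in hb, hx. assert (hn := qk_pos q hq n).
      assert (hn1 := qk_le_1 q hq n).
      replace (q / (Cmod b * / q ^ n * Cmod x))%R with (q / (Cmod b * Cmod x) * q ^ n)%R
        by (field; lra).
      rewrite <- (Rmult_1_r (q / (Cmod b * Cmod x))) at 2.
      apply Rmult_le_compat_l; [|exact hn1].
      left. apply Rdiv_lt_0_compat; [lra|now apply Rmult_lt_0_compat]. }
  destruct (CSeriesZ_tannery
     (fun n k => ell q (a * bn n) t k * triple_inf q a (bn n) q (qgrid q t k)) v
     (majorant q a b q t)) as [L _].
  - intros n k. destruct (Z_lt_le_dec 0 k) as [h|h].
    + rewrite Z by exact h. rewrite Cmod_0. apply majorant_pos.
    + replace k with (- Z.of_nat (Z.to_nat (- k)))%Z by lia.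
      eapply Rle_trans; [|apply (B n)]. rewrite Y.
      rewrite !Cmod_mult.
      assert (h1 : (Cmod (RtoC ((q ^ Z.to_nat (- k)) ^ n)%R) <= 1)%R).
      { rewrite <- pow_mult, Cmod_qpow by exact hq.
        now apply qk_le_1. }
      set (X := Cmod (ell q (a * b) t (- Z.of_nat (Z.to_nat (- k))))).
      set (Y' := Cmod (triple_inf q a (bn n) q (qgrid q t (- Z.of_nat (Z.to_nat (- k)))))).
      assert (0 <= X * Y')%R by (apply Rmult_le_pos; apply Cmod_ge_0). nra.
  - now apply majorant_summable.
  - intros k. unfold v. destruct (Z.eqb_spec k 0) as [->|hk].
    + apply Clim_ext with (fun n => t * (qpoch_inf q (- q * t) * qpoch_inf q (- (q / (a * t)))
                                           * qpoch_inf q (- (q / (bn n * t))))).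
      * intros n. now rewrite ell_0, qgrid_0.
      * apply Clim_scal, Clim_scal, qpoch_inf_near0; [exact hq|].
        apply Clim_ext with (2 := qgrid_lim_0 q hq 1 (- (q / (b * t)))).
        intros n. rewrite qgrid_nat. unfold bn. assert (hn := qpow_neq_0 q hq n).
        field; auto.
    + destruct (Z_lt_le_dec 0 k) as [h|h].
      * apply Clim_ext with (fun _ => 0); [|apply Clim_const].
        intros n. now rewrite Z.
      * replace k with (- Z.of_nat (Z.to_nat (- k)))%Z by lia.
        set (j := Z.to_nat (- k)).
        assert (hj : (1 <= j)%nat) by (unfold j; lia).
        apply is_lim_seq_0_dominated
          with (fun n => majorant q a b q t (- Z.of_nat j) * (q ^ j) ^ n)%R.
        -- intros n; split; [apply Cmod_ge_0|]. rewrite Y.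
           replace (ell q (a * b) t (- Z.of_nat j) * RtoC ((q ^ j) ^ n)%R *
             triple_inf q a (bn n) q (qgrid q t (- Z.of_nat j)) - 0)
             with (triple_inf q a (bn n) q (qgrid q t (- Z.of_nat j)) * ell q (a * b) t
                 (- Z.of_nat j)
                   * RtoC ((q ^ j) ^ n)%R) by ring.
           rewrite (Cmod_mult _ (RtoC _)), <- pow_mult, Cmod_qpow by exact hq.
           apply Rmult_le_compat_r; [left; now apply qk_pos|apply B].
        -- replace 0%R with (majorant q a b q t (- Z.of_nat j) * 0)%R by ring.
           apply (is_lim_seq_scal_l _ _ 0%R). apply is_lim_seq_geom.
           rewrite Rabs_pos_eq by (left; now apply qk_pos).
           destruct j as [|j]; [lia|]. simpl.
           assert (hj0 := qk_pos q hq j).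
           assert (hj1 := qk_le_1 q hq j).
           nra.
  - apply Clim_unique with (fun _ : nat => theta_sum q a b q t); [apply Clim_const|].
    apply Clim_ext with (fun n => qpoch q (q / b) n * theta_sum q a (bn n) q t).
    + intros n. symmetry. now apply theta_sum_at_zero_descent.
    + replace (t * (qpoch_inf q q * qpoch_inf q (q / a) * qpoch_inf q (q / b)))
        with (qpoch_inf q (q / b) * CSeriesZ v).
      * apply Clim_mult; [now apply qpoch_lim|exact L].
      * rewrite CSeriesZ_single.
        -- unfold v. simpl Z.eqb. cbv iota.
           replace (- q * t) with (q / a) by (unfold t; field; auto).
           replace (- (q / (a * t))) with (RtoC q) by (unfold t; field; auto).
           unfold t. ring.
        -- intros k hk. unfold v. destruct (Z.eqb_spec k 0); [contradiction|reflexivity].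
Qed.

(** [B_s(t) = theta(abst) theta(t/s)] is a theta pair with the same product [ab], so the
    3x3 determinant of the theta sum, the theta pair and [B_s] vanishes; [s] is a zero
    of [B_s] and [-1/a] is a zero of the theta pair, which leaves three of its six
    terms. *)
Lemma wronskian (a b s r : C) : a <> 0 -> b <> 0 -> s <> 0 -> r <> 0 ->
  theta_pair a b s <> 0 ->
  theta_sum q a b q r * theta_pair a b s - theta_sum q a b q s * theta_pair a b r
  = r * (theta q (a * b * s * r) * theta q (s / r))
    * (qpoch_inf q q * qpoch_inf q (q / a) * qpoch_inf q (q / b)).
Proof.
  intros ha hb hs hr hU.
  set (t := - / a). assert (ht : t <> 0) by (unfold t; auto using Copp_neq_0, Cinv_neq_0).
  assert (hab := Cmult_neq_0 _ _ ha hb).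
  (* The theta pair of [a'] and [b'] is [B_s], and [a' b' = a b]. *)
  set (a' := - (a * b * s)). set (b' := - / s).
  assert (ha' : a' <> 0) by (unfold a'; auto using Copp_neq_0, Cmult_neq_0).
  assert (hb' : b' <> 0) by (unfold b'; auto using Copp_neq_0, Cinv_neq_0).
  assert (HB := in_closure_theta_pair a' b' ha' hb').
  replace (a' * b') with (a * b) in HB by (unfold a', b'; field; auto).
  assert (D := in_closure_det3 q (a * b) _ _ _ r s t
      (in_closure_theta_sum q hq a b q ha hb) (in_closure_theta_pair a b ha hb) HB hr hs ht).
  unfold det3 in D.
  assert (Bs : theta_pair a' b' s = 0).
  { unfold theta_pair. rewrite (theta_eq0_1 (- b' * s)) by (unfold b'; field; auto). ring. }
  assert (Ut : theta_pair a b t = 0).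
  { unfold theta_pair. rewrite (theta_eq0_1 (- a * t)) by (unfold t; field; auto). ring. }
  assert (Bt : a * s * theta_pair a' b' t = theta_pair a b s).
  { unfold theta_pair. replace (- a' * t) with (- b * s) by (unfold a', t; field; auto).
    rewrite (theta_inv q hq (- a * s) (- b' * t)) by (unfold b', t; field; auto).
    unfold b', t. field; auto. }
  assert (Br : r * (theta q (a * b * s * r) * theta q (s / r)) = - s * theta_pair a' b' r).
  { unfold theta_pair. replace (- a' * r) with (a * b * s * r) by (unfold a'; ring).
    rewrite (theta_inv q hq (- b' * r) (s / r)) by (unfold b'; field; auto).
    field; auto. }
  assert (Tt := theta_sum_at_zero a b ha hb). fold t in Tt.
  rewrite Bs, Ut, Tt in D. rewrite Br.
  apply Cmult_reg_l with (theta_pair a b s); [exact hU|].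
  rewrite <- Bt at 1.
  set (T1 := theta_sum q a b q r) in *. set (T2 := theta_sum q a b q s) in *.
  apply Ceq_minus.
  transitivity (a * s * (T1 * (theta_pair a b s * theta_pair a' b' t - 0 * 0)
     - theta_pair a b r * (T2 * theta_pair a' b' t
           - t * (qpoch_inf q q * qpoch_inf q (q / a) * qpoch_inf q (q / b)) * 0)
     + theta_pair a' b' r * (T2 * 0 -
           t * (qpoch_inf q q * qpoch_inf q (q / a) * qpoch_inf q (q / b)) * theta_pair a b
           s))).
  - unfold t. field; auto.
  - unfold t in *. rewrite D. ring.
Qed.

End ThetaProducts.

(** * Sums of the weight *)

Section Weights.
Context (q : R) (hq : (0 < q < 1)%R).

(** The denominator of the weight does not vanish at [x]. *)
Definition regular_at (a b x : C) : Prop :=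
  qpoch_inf q (- a * x) <> 0 /\ qpoch_inf q (- b * x) <> 0.

Lemma regular_at_shift (a b x : C) i j : regular_at a b x ->
  regular_at (a * RtoC (q ^ i)%R) (b * RtoC (q ^ j)%R) x.
Proof.
  assert (H : forall (c : C) n, qpoch_inf q (- c * x) <> 0 ->
                qpoch_inf q (- (c * RtoC (q ^ n)%R) * x) <> 0).
  { intros c n h E. apply h.
    rewrite (qpoch_inf_split q hq (- c * x) (- (c * RtoC (q ^ n)%R) * x) n) by ring.
    rewrite E. ring. }
  intros [h1 h2]. split; now apply H.
Qed.

Lemma regular_at_sym (a b x : C) : regular_at a b x -> regular_at b a x.
Proof. intros [h1 h2]; now split. Qed.

Lemma weight_sym (a b x : C) : weight q a b x = weight q b a x.
Proof. unfold weight. f_equal. ring. Qed.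

(** Multiplying the weight by these polynomials only moves its parameters; all moments
    are therefore total masses. *)
Lemma weight_shift (a b x : C) i j : regular_at a b x ->
  qpoch q (- a * x) i * qpoch q (- b * x) j * weight q a b x
  = weight q (a * RtoC (q ^ i)%R) (b * RtoC (q ^ j)%R) x.
Proof.
  intros h. destruct (regular_at_shift a b x i j h) as [h1 h2].
  destruct h as [h3 h4]. unfold weight.
  rewrite (qpoch_inf_split q hq (- a * x) (- (a * RtoC (q ^ i)%R) * x) i) in * by ring.
  rewrite (qpoch_inf_split q hq (- b * x) (- (b * RtoC (q ^ j)%R) * x) j) in * by ring.
  assert (h5 : qpoch q (- a * x) i <> 0) by (intros E; apply h3; rewrite E; ring).
  assert (h6 : qpoch q (- b * x) j <> 0) by (intros E; apply h4; rewrite E; ring).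
  field. auto.
Qed.

Definition regular_on (a b t : C) : Prop := forall k, regular_at a b (qgrid q t k).

(** The integral from [0] to [oo(t)] of the weight, without the factor [1 - q]. *)
Definition sum_two_sided (a b t : C) : C := CSeriesZ (jackson_term q (weight q a b) t).

Lemma regular_on_shift (a b t : C) i j : regular_on a b t ->
  regular_on (a * RtoC (q ^ i)%R) (b * RtoC (q ^ j)%R) t.
Proof. intros H k. now apply regular_at_shift. Qed.

Lemma regular_on_sym (a b t : C) : regular_on a b t -> regular_on b a t.
Proof. intros H k. now apply regular_at_sym. Qed.

(** A zero of [(q/(-ct);q)_oo] is a zero of [(-cx;q)_oo] at a grid point [x = t q^-k]. *)
Lemma theta_pair_neq_0 (a b t : C) : a <> 0 -> b <> 0 -> t <> 0 -> regular_on a b t ->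
    theta_pair q a b t <> 0.
Proof.
  intros ha hb ht H.
  assert (G : forall c : C, c <> 0 -> (forall k, qpoch_inf q (- c * qgrid q t k) <> 0) ->
            theta q (- c * t) <> 0).
  { intros c hc Hc. unfold theta. apply Cmult_neq_0.
    - rewrite <- (qgrid_0 q t). apply Hc.
    - intros E. destruct (qpoch_inf_eq0 q hq _ E) as [k hk].
      apply (Hc (- Z.of_nat (S k))%Z).
      apply (qpoch_inf_zero q hq _ 0). rewrite pow_O, Cmult_1_r.
      assert (hn := qpow_neq_0 q hq (S k)). assert (hct := Cmult_neq_0 _ _ hc ht).
      assert (X := qgrid_neg q hq t (S k)).
      replace (qgrid q t (- Z.of_nat (S k))) with (t / RtoC (q ^ S k)%R)
        by (rewrite <- X at 1; field; auto).
      rewrite q_div_opp in hk by assumption.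
      assert (Y : RtoC (q ^ S k)%R = - (c * t)).
      { rewrite qpow_S. transitivity (- (c * t) * (- (q / (c * t)) * RtoC (q ^ k)%R)).
        - field; auto.
        - rewrite hk. ring. }
      rewrite Y. field; auto using Copp_neq_0. }
  apply Cmult_neq_0; apply G; auto; intros k; apply H.
Qed.

Lemma jackson_term_weight (a b t : C) k : a <> 0 -> b <> 0 -> t <> 0 ->
  regular_at a b (qgrid q t k) ->
  theta_pair q a b t * jackson_term q (weight q a b) t k
  = ell q (a * b) t k * triple_inf q a b q (qgrid q t k).
Proof.
  intros ha hb ht [h1 h2]. unfold jackson_term.
  transitivity (weight q a b (qgrid q t k) * (theta_pair q a b t * qgrid q t k)); [ring|].
  rewrite (theta_pair_grid q hq) by assumption.
  assert (hx := qgrid_neq_0 q hq t k ht).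
  unfold theta_pair, theta, weight, triple_inf.
  rewrite (q_div_opp q a), (q_div_opp q b) by assumption.
  field; auto.
Qed.

Lemma sum_two_sided_spec (a b t : C) : a <> 0 -> b <> 0 -> t <> 0 -> regular_on a b t ->
  abs_summableZ (jackson_term q (weight q a b) t)
  /\ theta_pair q a b t * sum_two_sided a b t = theta_sum q a b q t.
Proof.
  intros ha hb ht H. assert (hU := theta_pair_neq_0 a b t ha hb ht H).
  destruct (theta_sum_lim q hq a b q t ha hb ht) as [_ S].
  assert (E := fun k => jackson_term_weight a b t k ha hb ht (H k)).
  assert (S' : abs_summableZ (jackson_term q (weight q a b) t)).
  { apply abs_summableZ_ext with
      (fun k => / theta_pair q a b t *
          (ell q (a * b) t k * triple_inf q a b q (qgrid q t k))).
    - intros k. rewrite <- E. field; auto.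
    - now apply abs_summableZ_scal. }
  split; [exact S'|]. unfold sum_two_sided, theta_sum.
  rewrite <- CSeriesZ_scal by exact S'. apply CSeriesZ_ext. exact E.
Qed.

Lemma sum_two_sided_recurrence_r (a b t : C) : a <> 0 -> b <> 0 -> t <> 0 -> regular_on a b t
    ->
  (1 - b) * sum_two_sided a b t - a * sum_two_sided a (b * q) t = - (1).
Proof.
  intros ha hb ht H. assert (hq0 := q_neq_0 q hq).
  assert (hU := theta_pair_neq_0 a b t ha hb ht H).
  assert (H' : regular_on a (b * q) t).
  { intros k. destruct (regular_at_shift a b _ 0 1 (H k)) as [X Y]. split; [apply H|].
    simpl in Y. now rewrite Rmult_1_r in Y. }
  destruct (sum_two_sided_spec a b t ha hb ht H) as [_ E1].
  destruct (sum_two_sided_spec a (b * q) t ha (Cmult_neq_0 _ _ hb hq0) ht H') as [_ E2].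
  assert (R := theta_sum_recurrence q hq a b t ha hb ht). rewrite <- E1, <- E2 in R.
  assert (X : theta_pair q a b t = b * t * theta_pair q a (b * q) t).
  { unfold theta_pair. rewrite (theta_step q hq (- b * t) (- (b * q) * t)) by
      (try ring; apply Cmult_neq_0; auto using Copp_neq_0). ring. }
  apply Cmult_reg_l with (theta_pair q a b t); [exact hU|].
  transitivity ((1 - b) * (theta_pair q a b t * sum_two_sided a b t)
    - a * b * t * (theta_pair q a (b * q) t * sum_two_sided a (b * q) t)).
  - rewrite X. ring.
  - rewrite R. ring.
Qed.

Lemma sum_two_sided_sym (a b t : C) : sum_two_sided a b t = sum_two_sided b a t.
Proof.
  apply CSeriesZ_ext. intros k. unfold jackson_term. now rewrite weight_sym.
Qed.

Definition regular_half (a b : C) : Prop :=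
  forall k, regular_at a b (qgrid q (-1) (Z.of_nat k)).

(** The integral from [0] to [-1] of the weight, without the factor [1 - q]. *)
Definition sum_one_sided (a b : C) : C :=
  CSeries (fun k => jackson_term q (weight q a b) (-1) (Z.of_nat k)).

Lemma regular_half_shift (a b : C) i j : regular_half a b ->
  regular_half (a * RtoC (q ^ i)%R) (b * RtoC (q ^ j)%R).
Proof. intros H k. now apply regular_at_shift. Qed.

Lemma regular_half_sym (a b : C) : regular_half a b -> regular_half b a.
Proof. intros H k. now apply regular_at_sym. Qed.

Lemma weight_lim_1 (a b t : C) :
  Clim (fun n => weight q a b (qgrid q t (Z.of_nat n))) 1.
Proof.
  replace (RtoC 1) with (RtoC 1 * (RtoC 1 * RtoC 1)) by ring.
  unfold weight. apply Clim_mult.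
  - apply qpoch_inf_near0; auto using qgrid_lim_0.
  - replace (RtoC 1 * RtoC 1) with (RtoC 1) by ring. apply Clim_inv_1.
    rewrite <- (Cmult_1_l 1). apply Clim_mult; apply qpoch_inf_near0; auto using qgrid_lim_0.
Qed.

Lemma jackson_term_summable_half (f : C -> C) (t l : C) :
  Clim (fun n => f (qgrid q t (Z.of_nat n))) l ->
  abs_summable (fun k => jackson_term q f t (Z.of_nat k)).
Proof.
  intros Hf. destruct (Clim_bounded _ _ Hf) as [M [_ HM]].
  apply abs_summable_le with (fun n => (M * Cmod t) * q ^ n)%R.
  - intros n. unfold jackson_term. rewrite Cmod_mult.
    rewrite (qgrid_nat q t n) at 2. rewrite Cmod_mult, Cmod_qpow, Rmult_assoc by exact hq.
    apply Rmult_le_compat_r; [|apply HM].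
    apply Rmult_le_pos; [apply Cmod_ge_0|left; now apply qk_pos].
  - apply (ex_series_scal_l (M * Cmod t)%R (fun n => q ^ n)%R).
    apply ex_series_geom. rewrite Rabs_pos_eq; lra.
Qed.

Lemma sum_one_sided_summable (a b : C) :
  abs_summable (fun k => jackson_term q (weight q a b) (-1) (Z.of_nat k)).
Proof. apply jackson_term_summable_half with (RtoC 1), weight_lim_1. Qed.

(** Same relation as for the two-sided sums: the telescoping function [(1 + x) w(x)]
    vanishes at the endpoint [-1], as it does at infinity. *)
Lemma sum_one_sided_recurrence_r (a b : C) : regular_half a b ->
  (1 - b) * sum_one_sided a b - a * sum_one_sided a (b * q) = - (1).
Proof.
  intros H.
  set (x := fun k => qgrid q (-1) (Z.of_nat k)).
  assert (xS : forall k, x (S k) = x k * q).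
  { intros k. unfold x. rewrite <- qgrid_succ by exact hq. f_equal. lia. }
  set (g := fun k => (1 + x k) * weight q a b (x k)).
  assert (T := CSeries_telescope g 1).
  assert (L : Clim g 1).
  { enough (L : Clim g ((1 + 0) * 1)) by now rewrite Cplus_0_r, Cmult_1_r in L.
    apply Clim_mult; [|apply weight_lim_1].
    apply Clim_plus; [apply Clim_const|].
    apply Clim_ext with (2 := qgrid_lim_0 q hq (-1) 1). intros; unfold x; ring. }
  specialize (T L).
  rewrite (CSeries_ext _ (fun k =>
     (1 - b) * jackson_term q (weight q a b) (-1) (Z.of_nat k)
     + (- a) * jackson_term q (weight q a (b * q)) (-1) (Z.of_nat k))) in T.
  - rewrite (CSeries_plus (fun k => (1 - b) * jackson_term q (weight q a b) (-1)
        (Z.of_nat k)))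
      in T by (apply abs_summable_scal, sum_one_sided_summable).
    rewrite !CSeries_scal in T by apply sum_one_sided_summable.
    fold (sum_one_sided a b) (sum_one_sided a (b * q)) in T.
    transitivity ((1 - b) * sum_one_sided a b + - a * sum_one_sided a (b * q)); [ring|].
    rewrite T. unfold g, x. simpl Z.of_nat. rewrite qgrid_0.
    replace (1 + -1) with (RtoC 0) by (rewrite <- RtoC_plus; f_equal; ring). ring.
  - intros k. unfold g. rewrite xS. unfold jackson_term. fold (x k).
    assert (W1 := weight_shift a b (x k) 0 1 (H k)).
    simpl in W1. rewrite Rmult_1_r in W1. rewrite !Cmult_1_r in W1.
    rewrite <- W1.
    assert (P : (1 + x k * q) * weight q a b (x k * q)
                = (1 + a * x k) * (1 + b * x k) * weight q a b (x k)).
    { destruct (H k) as [h1 h2]. fold (x k) in h1, h2. unfold weight.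
      rewrite (qpoch_inf_step q hq (- a * x k) (- a * (x k * q))) in * by ring.
      rewrite (qpoch_inf_step q hq (- b * x k) (- b * (x k * q))) in * by ring.
      rewrite (qpoch_inf_step q hq (- q * x k) (- q * (x k * q))) by ring.
      set (X := qpoch_inf q (- a * (x k * q))) in *.
      set (Y := qpoch_inf q (- b * (x k * q))) in *.
      assert (X <> 0) by (intros E; apply h1; rewrite E; ring).
      assert (Y <> 0) by (intros E; apply h2; rewrite E; ring).
      assert (1 - - a * x k <> 0) by (intros E; apply h1; rewrite E; ring).
      assert (1 - - b * x k <> 0) by (intros E; apply h2; rewrite E; ring).
      field; repeat split; auto. }
    rewrite P. ring.
Qed.

Lemma sum_one_sided_sym (a b : C) : sum_one_sided a b = sum_one_sided b a.
Proof.
  apply CSeries_ext. intros k. unfold jackson_term. now rewrite weight_sym.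
Qed.

(** The terms of the theta sum at [x = -q^-k], [k >= 1], vanish with [(-qx;q)_oo]. *)
Lemma sum_one_sided_theta_sum (a b : C) : a <> 0 -> b <> 0 -> regular_half a b ->
  theta_pair q a b (-1) * sum_one_sided a b = theta_sum q a b q (-1).
Proof.
  intros ha hb H.
  assert (h1 : RtoC (-1) <> 0) by (intros E; apply RtoC_inj in E; lra).
  unfold sum_one_sided, theta_sum, CSeriesZ.
  rewrite <- CSeries_scal by apply sum_one_sided_summable.
  rewrite (CSeries_ext (fun n => ell q (a * b) (-1) (- Z.of_nat (S n)) * _)
             (fun n => (fun _ => 0) n - (fun _ => 0) (S n))).
  - rewrite (CSeries_telescope (fun _ => 0) 0) by apply Clim_const.
    transitivity (CSeries (fun n =>
       ell q (a * b) (-1) (Z.of_nat n) * triple_inf q a b q (qgrid q (-1) (Z.of_nat n))));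
           [|ring].
    apply CSeries_ext. intros n. now apply jackson_term_weight.
  - intros n. unfold triple_inf.
    rewrite (qpoch_inf_zero q hq (- q * qgrid q (-1) (- Z.of_nat (S n))) n); [ring|].
    assert (X := qgrid_neg q hq (-1) (S n)). rewrite qpow_S in X.
    transitivity (- (qgrid q (-1) (- Z.of_nat (S n)) * (q * RtoC (q ^ n)%R))); [ring|].
    rewrite X, <- RtoC_opp. f_equal. ring.
Qed.

(** For [a = q] the weight is [1/(-bx;q)_oo], and [x w(x)] is a difference of [w] at
    consecutive grid points up to the factor [-b]. *)
Lemma sum_one_sided_base (b : C) : b <> 0 -> regular_half q b ->
  b * sum_one_sided q b = 1 - / qpoch_inf q b.
Proof.
  intros hb H.
  set (x := fun k => qgrid q (-1) (Z.of_nat k)).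
  assert (xS : forall k, x (S k) = x k * q).
  { intros k. unfold x. rewrite <- qgrid_succ by exact hq. f_equal. lia. }
  set (g := fun k => / qpoch_inf q (- b * x k)).
  assert (T := CSeries_telescope g 1
    (Clim_inv_1 _ (qpoch_inf_near0 q hq _ (qgrid_lim_0 q hq (-1) (- b))))).
  rewrite (CSeries_ext _ (fun k => (- b) * jackson_term q (weight q q b) (-1) (Z.of_nat k)))
      in T.
  - rewrite CSeries_scal in T by apply sum_one_sided_summable. fold (sum_one_sided q b) in T.
    transitivity (- (- b * sum_one_sided q b)); [ring|]. rewrite T. unfold g, x.
    simpl Z.of_nat. rewrite qgrid_0.
    replace (- b * -1) with b by (transitivity (b * - (-1)); [|ring];
      rewrite <- RtoC_opp; replace (- -1)%R with 1%R by ring; ring).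
    ring.
  - intros k. unfold g, jackson_term. rewrite xS. fold (x k).
    destruct (H k) as [h1 h2]. fold (x k) in h1, h2. unfold weight.
    rewrite (qpoch_inf_step q hq (- b * x k) (- b * (x k * q))) in * by ring.
    set (Y := qpoch_inf q (- b * (x k * q))) in *.
    assert (Y <> 0) by (intros E; apply h2; rewrite E; ring).
    assert (1 - - b * x k <> 0) by (intros E; apply h2; rewrite E; ring).
    field; repeat split; auto.
Qed.

(** * Total masses *)

Lemma qpoch_inf_neq_0 (a : C) :
  (forall k, a <> RtoC (/ q ^ k)%R) -> qpoch_inf q a <> 0.
Proof.
  intros H E. destruct (qpoch_inf_eq0 q hq a E) as [k hk]. apply (H k).
  assert (hn := qpow_neq_0 q hq k).
  rewrite RtoC_inv by (apply pow_nonzero; lra).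
  rewrite <- (Cmult_1_l (/ _)), <- hk. field; auto.
Qed.

Lemma mass2_spec (a b s r : C) :
  a <> 0 -> b <> 0 -> s <> 0 -> r <> 0 ->
  (forall k, a <> RtoC (/ q ^ k)%R) -> (forall k, b <> RtoC (/ q ^ k)%R) ->
  regular_on a b s -> regular_on a b r ->
  (1 - q) * (sum_two_sided a b r - sum_two_sided a b s) = mass2 q a b s r.
Proof.
  intros ha hb hs hr hqa hqb Hs Hr.
  assert (Us := theta_pair_neq_0 a b s ha hb hs Hs).
  assert (Ur := theta_pair_neq_0 a b r ha hb hr Hr).
  destruct (sum_two_sided_spec a b s ha hb hs Hs) as [_ Es].
  destruct (sum_two_sided_spec a b r ha hb hr Hr) as [_ Er].
  assert (W := wronskian q hq a b s r ha hb hs hr Us). rewrite <- Es, <- Er in W.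
  assert (Ea := qpoch_inf_neq_0 a hqa). assert (Eb := qpoch_inf_neq_0 b hqb).
  assert (X : sum_two_sided a b r - sum_two_sided a b s
     = (theta_pair q a b r * sum_two_sided a b r * theta_pair q a b s - theta_pair q a b
         s * sum_two_sided a b s * theta_pair q a b r)
       / (theta_pair q a b r * theta_pair q a b s)) by (field; auto).
  rewrite X, W. unfold mass2.
  unfold theta_pair in *. destruct (Cmult_neq_0_inv _ _ Us).
  destruct (Cmult_neq_0_inv _ _ Ur).
  change (theta q a) with (qpoch_inf q a * qpoch_inf q (q / a)).
  change (theta q b) with (qpoch_inf q b * qpoch_inf q (q / b)).
  field. repeat split; auto.
Qed.

(** [mass1] without the factor [1 - q]. *)
Definition mass1_sum (a b t : C) : C :=
  t * (qpoch_inf q q / (qpoch_inf q a * qpoch_inf q b))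
  * ((theta q (- a * b * t) * theta q (- 1 / t))
     / (theta q (- a * t) * theta q (- b * t))).

Lemma mass1_sum_sym (a b t : C) : mass1_sum a b t = mass1_sum b a t.
Proof.
  unfold mass1_sum. replace (- a * b * t) with (- b * a * t) by ring.
  rewrite (Cmult_comm (qpoch_inf q a)), (Cmult_comm (theta q (- a * t))). reflexivity.
Qed.

(** The case where neither [a] nor [b] is a positive power of [q], that is,
    [theta(a) theta(b) <> 0]: apply [wronskian] at [t] and [-1]. *)
Lemma mass1_generic (a b t : C) :
  a <> 0 -> b <> 0 -> t <> 0 ->
  qpoch_inf q a <> 0 -> qpoch_inf q b <> 0 ->
  qpoch_inf q (q / a) <> 0 -> qpoch_inf q (q / b) <> 0 ->
  regular_half a b -> regular_on a b t ->
  sum_two_sided a b t - sum_one_sided a b = mass1_sum a b t.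
Proof.
  intros ha hb ht Ea Eb Fa Fb Hs Hr.
  assert (h1 : RtoC (-1) <> 0) by (intros E; apply RtoC_inj in E; lra).
  assert (m1 : RtoC (-1) = - (1)) by (rewrite <- RtoC_opp; reflexivity).
  assert (Ut := theta_pair_neq_0 a b t ha hb ht Hr).
  destruct (sum_two_sided_spec a b t ha hb ht Hr) as [_ Et].
  assert (Eh := sum_one_sided_theta_sum a b ha hb Hs).
  assert (U1 : theta_pair q a b (-1) = qpoch_inf q a * qpoch_inf q (q / a)
                              * (qpoch_inf q b * qpoch_inf q (q / b))).
  { unfold theta_pair, theta. rewrite m1. replace (- a * - (1)) with a by ring.
    replace (- b * - (1)) with b by ring. reflexivity. }
  assert (Us : theta_pair q a b (-1) <> 0) by (rewrite U1; auto using Cmult_neq_0).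
  assert (W := wronskian q hq a b (-1) t ha hb h1 ht Us). rewrite <- Eh, <- Et in W.
  assert (X : sum_two_sided a b t - sum_one_sided a b
     = (theta_pair q a b t * sum_two_sided a b t * theta_pair q a b (-1) - theta_pair q a b
         (-1) * sum_one_sided a b * theta_pair q a b t)
       / (theta_pair q a b t * theta_pair q a b (-1))) by (field; auto).
  rewrite X, W, U1. unfold mass1_sum.
  replace (a * b * -1 * t) with (- a * b * t) by (rewrite m1; ring).
  unfold theta_pair in *. destruct (Cmult_neq_0_inv _ _ Ut).
  field. repeat split; auto.
Qed.

Lemma qpoch_inf_qpow_neq_0 i : qpoch_inf q (RtoC (q ^ S i)%R) <> 0.
Proof.
  intros E. destruct (qpoch_inf_eq0 q hq _ E) as [n hn].
  rewrite <- RtoC_mult, <- pow_add in hn. apply RtoC_inj in hn. simpl in hn.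
  assert (Y := qk_le_1 q hq (i + n)). assert (Y' := qk_pos q hq (i + n)). nra.
Qed.

Lemma regular_on_q_power (b t : C) (T : R) i :
  t = RtoC T -> (0 < T)%R -> (forall k, qpoch_inf q (- b * qgrid q t k) <> 0) ->
  regular_on (RtoC (q ^ i)%R) b t.
Proof.
  intros -> hT Hb k. split; [|apply Hb].
  intros E. destruct (qpoch_inf_eq0 q hq _ E) as [n hn].
  unfold qgrid in hn. rewrite <- RtoC_opp, <- !RtoC_mult in hn. apply RtoC_inj in hn.
  assert (0 < q ^ i * (T * powerRZ q k) * q ^ n)%R.
  { repeat apply Rmult_lt_0_compat; auto; try now apply qk_pos. apply powerRZ_lt; lra. }
  lra.
Qed.

Lemma regular_half_q_power (b : C) i :
  (forall k, qpoch_inf q (- b * qgrid q (-1) (Z.of_nat k)) <> 0) ->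
  regular_half (RtoC (q ^ S i)%R) b.
Proof.
  intros Hb k. split; [|apply Hb].
  intros E. destruct (qpoch_inf_eq0 q hq _ E) as [n hn].
  rewrite qgrid_nat, <- RtoC_opp, <- !RtoC_mult in hn. apply RtoC_inj in hn.
  assert (X : (q ^ (S (i + k + n)) = 1)%R) by (simpl; rewrite !pow_add; simpl in hn; lra).
  assert (Y := qk_le_1 q hq (i + k + n)).
  assert (Y' := qk_pos q hq (i + k + n)). simpl in X. nra.
Qed.

(** Here [theta(a) = 0], and the information at [-1] is lost after multiplication by
    the theta pair. Both sides satisfy [b F(aq) = (1 - a) F(a)], which reduces the
    claim to [a = q]. *)
Lemma mass1_q_power (b t : C) (T : R) i :
  t = RtoC T -> (0 < T)%R -> b <> 0 -> qpoch_inf q b <> 0 ->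
  (forall k, qpoch_inf q (- b * qgrid q t k) <> 0) ->
  (forall k, qpoch_inf q (- b * qgrid q (-1) (Z.of_nat k)) <> 0) ->
  sum_two_sided (RtoC (q ^ S i)%R) b t - sum_one_sided (RtoC (q ^ S i)%R) b
      = mass1_sum (RtoC (q ^ S i)%R) b t.
Proof.
  intros hT T0 hb Eb Hb Hb1. assert (hq0 := q_neq_0 q hq).
  assert (ht : t <> 0) by (rewrite hT; intros E; apply RtoC_inj in E; lra).
  assert (m1 : RtoC (-1) = - (1)) by (rewrite <- RtoC_opp; reflexivity).
  assert (Reg : forall j, regular_on (RtoC (q ^ j)%R) b t)
    by (intros j; now apply regular_on_q_power with T).
  assert (Nz := fun j => Cmult_neq_0_inv _ _
      (theta_pair_neq_0 _ b t (qpow_neq_0 q hq j) hb ht (Reg j))).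
  induction i as [|i IH].
  - simpl. rewrite Rmult_1_r.
    assert (R1 := Reg 0%nat). assert (R2 := Reg 1%nat). simpl in R1, R2.
    rewrite Rmult_1_r in R2.
    (* On the grid of a positive [t] the parameter value [a = 1] is regular, and the
       recurrence there evaluates the two-sided sum at [a = q]. *)
    assert (Rec := sum_two_sided_recurrence_r b 1 t hb C1_nz ht (regular_on_sym _ _ _ R1)).
    rewrite Cmult_1_l, sum_two_sided_sym, (sum_two_sided_sym b) in Rec.
    assert (R3 := regular_half_q_power b 0 Hb1). simpl in R3. rewrite Rmult_1_r in R3.
    assert (HB := sum_one_sided_base b hb R3).
    apply Cmult_reg_l with b; [exact hb|].
    transitivity (b * sum_two_sided q b t - b * sum_one_sided q b); [ring|]. rewrite HB.
    replace (b * sum_two_sided q b t) with (RtoC 1)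
      by (apply Ceq_minus; rewrite <- (Cplus_opp_r 1), <- Rec; ring).
    unfold mass1_sum.
    assert (Eq := qpoch_inf_qpow_neq_0 0). simpl in Eq. rewrite Rmult_1_r in Eq.
    destruct (Nz 1%nat) as [N1 N2]. simpl in N1. rewrite Rmult_1_r in N1.
    assert (hbt : - b * t <> 0) by auto using Cmult_neq_0, Copp_neq_0.
    replace (theta q (- q * b * t)) with (theta q (- b * t) / (b * t)).
    + replace (theta q (- 1 / t)) with (theta q (- q * t)).
      * field; repeat split; auto.
      * symmetry. apply (theta_inv_q q hq); [rewrite m1; field; auto|].
        auto using Cmult_neq_0, Copp_neq_0.
    + rewrite (theta_step q hq (- b * t) (- q * b * t)) by (auto; ring). field; auto.
  - set (a := RtoC (q ^ S i)%R) in *.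
    assert (ha : a <> 0) by now apply qpow_neq_0.
    replace (RtoC (q ^ S (S i))%R) with (a * q) by (rewrite (qpow_S q (S i)); unfold a; ring).
    assert (Rec1 := sum_two_sided_recurrence_r b a t hb ha ht
        (regular_on_sym _ _ _ (Reg (S i)))).
    assert (Rec2 := sum_one_sided_recurrence_r b a
        (regular_half_sym _ _ (regular_half_q_power b i Hb1))).
    rewrite sum_two_sided_sym, (sum_two_sided_sym b) in Rec1.
    rewrite sum_one_sided_sym, (sum_one_sided_sym b) in Rec2.
    apply Cmult_reg_l with b; [exact hb|].
    transitivity ((1 - a) * (sum_two_sided a b t - sum_one_sided a b)).
    + apply Ceq_minus.
      transitivity (((1 - a) * sum_one_sided a b - b * sum_one_sided (a * q) b)
                    - ((1 - a) * sum_two_sided a b t - b * sum_two_sided (a * q) b t));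
                          [ring|].
      rewrite Rec1, Rec2. ring.
    + rewrite IH. unfold mass1_sum.
      destruct (Nz (S i)) as [N1 N2]. fold a in N1.
      destruct (Nz (S (S i))) as [N3 _].
      replace (RtoC (q ^ S (S i))%R) with (a * q) in N3
        by (rewrite (qpow_S q (S i)); unfold a; ring).
      assert (Ea := qpoch_inf_qpow_neq_0 i). fold a in Ea.
      rewrite (qpoch_inf_step q hq a (a * q) eq_refl) in *.
      destruct (Cmult_neq_0_inv _ _ Ea) as [Ea1 Ea2].
      rewrite (theta_step q hq (- a * t) (- (a * q) * t)) in * by
        (try ring; auto using Cmult_neq_0, Copp_neq_0).
      rewrite (theta_step q hq (- a * b * t) (- (a * q) * b * t)) by
        (try ring; auto using Cmult_neq_0, Copp_neq_0).
      field; repeat split; auto.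
Qed.

Lemma mass1_spec (a b t : C) (T : R) :
  t = RtoC T -> (0 < T)%R ->
  a <> 0 -> b <> 0 ->
  (forall k, a <> RtoC (/ q ^ k)%R) -> (forall k, b <> RtoC (/ q ^ k)%R) ->
  regular_half a b -> regular_on a b t ->
  sum_two_sided a b t - sum_one_sided a b = mass1_sum a b t.
Proof.
  intros hT T0 ha hb hqa hqb Hs Hr.
  assert (ht : t <> 0) by (rewrite hT; intros E; apply RtoC_inj in E; lra).
  assert (Ea := qpoch_inf_neq_0 a hqa). assert (Eb := qpoch_inf_neq_0 b hqb).
  assert (P : forall c : C, c <> 0 -> qpoch_inf q (q / c) = 0 -> exists i, c
      = RtoC (q ^ S i)%R).
  { intros c hc E. destruct (qpoch_inf_eq0 q hq _ E) as [i hi]. exists i.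
    rewrite qpow_S. rewrite <- (Cmult_1_r c), <- hi. field; auto. }
  destruct (classic (qpoch_inf q (q / a) = 0)) as [Fa|Fa].
  - destruct (P a ha Fa) as [i ->].
    apply mass1_q_power with T; auto; intros k; [apply Hr|apply Hs].
  - destruct (classic (qpoch_inf q (q / b) = 0)) as [Fb|Fb].
    + destruct (P b hb Fb) as [i ->].
      rewrite sum_two_sided_sym, sum_one_sided_sym, mass1_sum_sym.
      apply mass1_q_power with T; auto; intros k; [apply Hr|apply Hs].
    + now apply mass1_generic.
Qed.

End Weights.

(** * Orthogonality from the contiguous relations *)

Fixpoint Csum (u : nat -> C) (n : nat) : C :=
  match n with
  | O => 0
  | S k => Csum u k + u k
  end.

Lemma Csum_ext u v n : (forall k, (k < n)%nat -> u k = v k) -> Csum u n = Csum v n.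
Proof.
  induction n as [|n IH]; simpl; intros H; [reflexivity|].
  rewrite IH, H by auto. reflexivity.
Qed.

Lemma Csum_first u n : Csum u (S n) = u 0%nat + Csum (fun k => u (S k)) n.
Proof.
  induction n as [|n IH]; [simpl; ring|].
  change (Csum u (S (S n))) with (Csum u (S n) + u (S n)). rewrite IH. simpl. ring.
Qed.

Lemma Csum_lin u v c e n :
  Csum (fun k => c * u k + e * v k) n = c * Csum u n + e * Csum v n.
Proof. induction n as [|n IH]; simpl; [ring|]. rewrite IH. ring. Qed.

Lemma CSeries_finite (u : nat -> C) n : (forall k, (n <= k)%nat -> u k = 0) -> CSeries u
    = Csum u n.
Proof.
  revert u. induction n as [|n IH]; intros u H.
  - rewrite (CSeries_ext u (fun k => (fun _ => 0) k - (fun _ => 0) (S k))).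
    + rewrite (CSeries_telescope (fun _ => 0) 0) by apply Clim_const. simpl. ring.
    + intros k. rewrite H by lia. ring.
  - rewrite CSeries_S, Csum_first.
    + f_equal. apply IH. intros k hk. apply H. lia.
    + apply ex_series_ratio with 0%R (S n); [intros; apply Cmod_ge_0|lra|].
      intros k hk. rewrite H, Cmod_0 by lia. lra.
Qed.

Section Orthogonality.
Context (q : R) (hq : (0 < q < 1)%R).

Lemma qpoch_q_neq_0 n : qpoch q q n <> 0.
Proof.
  intros E. destruct (qpoch_eq0 q _ _ E) as [k [_ hk]].
  rewrite <- RtoC_mult in hk. apply RtoC_inj in hk.
  assert (Y := qk_le_1 q hq k).
  assert (Y' := qk_pos q hq k). nra.
Qed.

Lemma RtoC_inv_qpow n : RtoC (/ q ^ n)%R = / RtoC (q ^ n)%R.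
Proof. apply RtoC_inv. apply pow_nonzero; lra. Qed.

Lemma qpoch_neq_0 (a : C) n :
  (forall k, a <> RtoC (/ q ^ k)%R) -> qpoch q a n <> 0.
Proof.
  intros H E. apply (qpoch_inf_neq_0 q hq a H).
  rewrite (qpoch_inf_split q hq a _ n eq_refl), E. ring.
Qed.

Lemma qpoch_qinv_zero n k : (n < k)%nat -> qpoch q (RtoC (/ q ^ n)%R) k = 0.
Proof.
  intros h. replace k with (S n + (k - S n))%nat by lia.
  rewrite qpoch_add. simpl qpoch.
  rewrite RtoC_inv_qpow, Cinv_l by now apply qpow_neq_0. ring.
Qed.

(** Signed Gaussian binomial coefficients, in the form in which they occur in [m_n]. *)
Definition sgauss (n k : nat) : C :=
  qpoch q (RtoC (/ q ^ n)%R) k / qpoch q q k * RtoC (q ^ n)%R ^ k.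

Lemma sgauss_pascal n k :
  sgauss (S n) (S k) = sgauss n (S k) - RtoC (q ^ n)%R * sgauss n k.
Proof.
  assert (hn := qpow_neq_0 q hq n). assert (hk := qpoch_q_neq_0 k).
  assert (hk' := qpoch_q_neq_0 (S k)). assert (hq0 := q_neq_0 q hq).
  unfold sgauss. rewrite (qpoch_S_first q (RtoC (/ q ^ S n)%R) k).
  replace (RtoC (/ q ^ S n)%R * q) with (RtoC (/ q ^ n)%R)
    by (rewrite !RtoC_inv_qpow, qpow_S; field; auto).
  replace (RtoC (q ^ S n)%R ^ S k) with
      (RtoC (q ^ n)%R ^ k * RtoC (q ^ n)%R * (RtoC (q ^ k)%R * q)).
  2:{ rewrite qpow_S, Cpow_S, Cpow_mult_l, (RtoC_pow q k). ring. }
  rewrite (Cpow_S _ k). simpl qpoch in *. rewrite !RtoC_inv_qpow, qpow_S.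
  assert (hk2 : 1 - q * RtoC (q ^ k)%R <> 0) by (intros E; apply hk'; rewrite E; ring).
  field; repeat split; auto.
Qed.

(** The finite q-binomial theorem. *)
Lemma sgauss_sum n (y : C) : Csum (fun k => sgauss n k * y ^ k) (S n) = qpoch q y n.
Proof.
  assert (Z : forall m, sgauss m (S m) = 0).
  { intros m. unfold sgauss. rewrite qpoch_qinv_zero by lia. unfold Cdiv. ring. }
  induction n as [|n IH].
  - simpl. unfold sgauss. simpl. field.
  - rewrite Csum_first.
    rewrite (Csum_ext _ (fun k => 1 * (sgauss n (S k) * y ^ S k)
                 + (- (RtoC (q ^ n)%R * y)) * (sgauss n k * y ^ k)))
      by (intros k _; rewrite sgauss_pascal, Cpow_S; ring).
    rewrite Csum_lin, IH.
    assert (E := Csum_first (fun k => sgauss n k * y ^ k) (S n)).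
    change (Csum (fun k => sgauss n k * y ^ k) (S (S n)))
      with (Csum (fun k => sgauss n k * y ^ k) (S n) + sgauss n (S n) * y ^ S n) in E.
    rewrite Z, IH in E.
    replace (sgauss (S n) 0) with (sgauss n 0) by (unfold sgauss; simpl; ring).
    transitivity ((sgauss n 0 * y ^ 0 + Csum (fun k => sgauss n (S k) * y ^ S k) (S n))
                  - RtoC (q ^ n)%R * y * qpoch q y n); [ring|].
    rewrite <- E. simpl qpoch. ring.
Qed.

(** The square avoids the sign and the triangular exponent in
    [(q^-n;q)_n = (-1)^n q^(-n(n+1)/2) (q;q)_n]. *)
Lemma qpoch_qinv_sqr n :
  let z := qpoch q (RtoC (/ q ^ n)%R) n in
  z * z * (RtoC (q ^ n)%R ^ n * RtoC (q ^ n)%R) = qpoch q q n * qpoch q q n.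
Proof.
  cbv zeta. assert (hq0 := q_neq_0 q hq). induction n as [|n IH].
  - simpl. ring.
  - assert (hn := qpow_neq_0 q hq n).
    rewrite (qpoch_S_first q (RtoC (/ q ^ S n)%R) n).
    replace (RtoC (/ q ^ S n)%R * q) with (RtoC (/ q ^ n)%R)
      by (rewrite !RtoC_inv_qpow, qpow_S; field; auto).
    replace (RtoC (q ^ S n)%R ^ S n * RtoC (q ^ S n)%R)
      with (RtoC (q ^ n)%R ^ n * RtoC (q ^ n)%R * (RtoC (q ^ S n)%R * RtoC (q ^ S n)%R)).
    2:{ assert (X : RtoC (q ^ S n)%R ^ n = RtoC (q ^ n)%R ^ n * RtoC (q ^ n)%R)
          by (rewrite qpow_S, Cpow_mult_l, <- RtoC_pow; ring).
        rewrite Cpow_S, X. ring. }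
    simpl qpoch.
    transitivity ((qpoch q (RtoC (/ q ^ n)%R) n * qpoch q (RtoC (/ q ^ n)%R) n
       * (RtoC (q ^ n)%R ^ n * RtoC (q ^ n)%R))
       * ((RtoC (q ^ S n)%R - 1) * (RtoC (q ^ S n)%R - 1))).
    + rewrite RtoC_inv_qpow. assert (hn' := qpow_neq_0 q hq (S n)). field; auto.
    + rewrite IH, qpow_S. ring.
Qed.

Context (a b : C) (ha0 : a <> 0)
  (ha : forall k : nat, a <> RtoC (/ q ^ k)%R)
  (hb : forall k : nat, b <> RtoC (/ q ^ k)%R).

Definition m_coef (n k : nat) : C :=
  / qpoch q a n * (sgauss n k / qpoch q b k * a ^ k).

Lemma m_poly_sum n x :
  m_poly q a b n x = Csum (fun k => m_coef n k * qpoch q (- b * x) k) (S n).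
Proof.
  unfold m_poly, phi21. rewrite (CSeries_finite _ (S n)).
  - assert (X : forall u m, / qpoch q a n * Csum u m = Csum (fun k => / qpoch q a n * u k) m).
    { intros u m. induction m as [|m IH]; simpl; [ring|]. rewrite <- IH. ring. }
    rewrite X. apply Csum_ext. intros k _. unfold m_coef, sgauss.
    rewrite Cpow_mult_l.
    assert (h1 := qpoch_q_neq_0 k). assert (h2 := qpoch_neq_0 b k hb).
    assert (h3 := qpoch_neq_0 a n ha). field. auto.
  - intros k hk. rewrite qpoch_qinv_zero by lia.
    unfold Cdiv. ring.
Qed.

(** Integration against the weight [w] is kept abstract so that one argument serves
    every choice of the grids: [dom] stands for the integrable functions and [L] for
    the integral. *)
Context (dom : (C -> C) -> Prop) (L : (C -> C) -> C) (w : C -> C).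

Definition mom_fun (i j : nat) (x : C) : C :=
  qpoch q (- a * x) i * qpoch q (- b * x) j * w x.

Context
  (lin : forall f g c e, dom f -> dom g ->
     dom (fun x => c * f x + e * g x) /\ L (fun x => c * f x + e * g x) = c * L f + e * L g)
  (mom_dom : forall i j, dom (mom_fun i j))
  (mom_l : forall i j, b * RtoC (q ^ j)%R * L (mom_fun (S i) j)
                       = (1 - a * RtoC (q ^ i)%R) * L (mom_fun i j))
  (mom_r : forall i j, a * RtoC (q ^ i)%R * L (mom_fun i (S j))
                       = (1 - b * RtoC (q ^ j)%R) * L (mom_fun i j)).

Lemma L_Csum (c : nat -> C) (f : nat -> C -> C) n :
  (forall k, (k < S n)%nat -> dom (f k)) ->
  dom (fun x => Csum (fun k => c k * f k x) (S n)) /\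
  L (fun x => Csum (fun k => c k * f k x) (S n)) = Csum (fun k => c k * L (f k)) (S n).
Proof.
  induction n as [|n IH]; intros H.
  - destruct (lin (f 0%nat) (f 0%nat) (c 0%nat) 0) as [A B]; [auto|auto|].
    simpl.
    replace (fun x => 0 + c 0%nat * f 0%nat x)
      with (fun x => c 0%nat * f 0%nat x + 0 * f 0%nat x)
      by (apply functional_extensionality; intros; ring).
    split; [exact A|]. rewrite B. ring.
  - destruct IH as [A B]; [auto|].
    destruct (lin (fun x => Csum (fun k => c k * f k x) (S n)) (f (S n)) 1 (c (S n)))
      as [A' B']; [exact A|auto|].
    change (fun x => Csum (fun k => c k * f k x) (S (S n)))
      with (fun x => Csum (fun k => c k * f k x) (S n) + c (S n) * f (S n) x).
    replace (fun x => Csum (fun k => c k * f k x) (S n) + c (S n) * f (S n) x)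
      with (fun x => 1 * Csum (fun k => c k * f k x) (S n) + c (S n) * f (S n) x)
      by (apply functional_extensionality; intros; ring).
    split; [exact A'|]. rewrite B', B. simpl. ring.
Qed.

(** Written without divisions, as is [mom_row]: the moments are
    [(a;q)_i (b;q)_k / (b^i a^k q^(ik))] times the total mass. *)
Lemma mom_col i k :
  a ^ k * RtoC (q ^ i)%R ^ k * L (mom_fun i k) = qpoch q b k * L (mom_fun i 0).
Proof.
  induction k as [|k IH]; [simpl; ring|].
  rewrite !Cpow_S. simpl qpoch.
  transitivity (a ^ k * RtoC (q ^ i)%R ^ k * (a * RtoC (q ^ i)%R * L (mom_fun i (S k))));
    [ring|].
  rewrite mom_r.
  transitivity ((1 - b * RtoC (q ^ k)%R) * (a ^ k * RtoC (q ^ i)%R ^ k * L (mom_fun i k)));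
    [ring|].
  rewrite IH. ring.
Qed.

Lemma mom_row i : b ^ i * L (mom_fun i 0) = qpoch q a i * L (mom_fun 0 0).
Proof.
  induction i as [|i IH]; [simpl; ring|].
  rewrite Cpow_S. simpl qpoch.
  transitivity (b ^ i * (b * RtoC (q ^ 0)%R * L (mom_fun (S i) 0))); [simpl; ring|].
  rewrite mom_l.
  transitivity ((1 - a * RtoC (q ^ i)%R) * (b ^ i * L (mom_fun i 0))); [ring|].
  rewrite IH. ring.
Qed.

Definition m_fun (n i k : nat) (x : C) : C := m_poly q a b n x * mom_fun i k x.

(** After [mom_col] the sum over the terms of [m_n] is that of the q-binomial theorem
    at [q^-i]. *)
Lemma m_fun_row n i : (i <= n)%nat ->
  dom (m_fun n i 0) /\
  L (m_fun n i 0) = / qpoch q a n * L (mom_fun i 0)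
                    * qpoch q (RtoC (/ q ^ i)%R) n.
Proof.
  intros hi.
  assert (E : m_fun n i 0 = fun x => Csum (fun k => m_coef n k * mom_fun i k x) (S n)).
  { apply functional_extensionality. intros x. unfold m_fun. rewrite m_poly_sum.
    assert (X : forall u v m, (forall k, u k * mom_fun i 0 x = v k) ->
               Csum u m * mom_fun i 0 x = Csum v m).
    { intros u v m H. induction m as [|m IH]; simpl; [ring|]. rewrite <- IH, <- H. ring. }
    apply X. intros k. unfold mom_fun. simpl. ring. }
  rewrite E. destruct (L_Csum (m_coef n) (mom_fun i) n) as [A B]; [auto|].
  split; [exact A|]. rewrite B, <- (sgauss_sum n (RtoC (/ q ^ i)%R)).
  assert (X : forall (c : C) (u : nat -> C) m, c * Csum u m = Csum (fun k => c * u k) m).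
  { intros c u m. induction m as [|m IH]; simpl; [ring|]. rewrite <- IH. ring. }
  rewrite X. apply Csum_ext. intros k _. unfold m_coef.
  assert (h1 := qpoch_neq_0 b k hb). assert (h2 := qpoch_neq_0 a n ha).
  assert (h3 := qpow_neq_0 q hq i). assert (h4 := Cpow_nz _ k h3).
  rewrite RtoC_inv_qpow, Cpow_inv by assumption.
  apply Cmult_reg_l with (qpoch q b k * RtoC (q ^ i)%R ^ k); [now apply Cmult_neq_0|].
  transitivity (/ qpoch q a n * sgauss n k * (a ^ k * RtoC (q ^ i)%R ^ k * L (mom_fun i k)));
    [field; auto|].
  rewrite mom_col. field; auto.
Qed.

(** Induction on [k]: with [beta] the ratio of the linear coefficients,
    [1 + bxq^k = beta (1 + axq^i) + (1 - beta)], which trades a factor in [b] for a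
    factor in [a] and a term of lower degree. *)
Lemma m_fun_spec n k i : (i + k <= n)%nat ->
  dom (m_fun n i k) /\
  ((i + k < n)%nat -> L (m_fun n i k) = 0) /\
  ((i + k = n)%nat ->
   a ^ k * RtoC (q ^ i)%R ^ k * L (m_fun n i k) = b ^ k * L (m_fun n n 0)).
Proof.
  revert i. induction k as [|k IH]; intros i hik.
  - destruct (m_fun_row n i) as [A B]; [lia|]. split; [exact A|split].
    + intros h. rewrite B.
      rewrite qpoch_qinv_zero by lia. ring.
    + intros h. replace i with n by lia. simpl. ring.
  - destruct (IH i) as [A1 [B1 C1]]; [lia|].
    destruct (IH (S i)) as [A2 [B2 C2]]; [lia|].
    assert (hi := qpow_neq_0 q hq i).
    set (beta := b * RtoC (q ^ k)%R / (a * RtoC (q ^ i)%R)).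
    assert (E : m_fun n i (S k) = fun x => beta * m_fun n (S i) k x + (1 - beta) * m_fun n i
        k x).
    { apply functional_extensionality. intros x. unfold m_fun, mom_fun. simpl qpoch.
      unfold beta. field; auto. }
    rewrite E. destruct (lin _ _ beta (1 - beta) A2 A1) as [A B].
    split; [exact A|]. rewrite B, B1 by lia. split.
    + intros h. rewrite B2 by lia. ring.
    + intros h. specialize (C2 ltac:(lia)).
      rewrite qpow_S, Cpow_mult_l, <- (RtoC_pow q k) in C2.
      assert (hqk := qpow_neq_0 q hq k).
      transitivity (a * RtoC (q ^ i)%R * beta / RtoC (q ^ k)%R
        * (a ^ k * (RtoC (q ^ k)%R * RtoC (q ^ i)%R ^ k) * L (m_fun n (S i) k))).
      * rewrite !Cpow_S. field; auto.
      * rewrite C2. unfold beta. rewrite Cpow_S. field; auto.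
Qed.

(** Expand the factor of lower degree; by [m_fun_spec] at most its top term
    contributes. *)
Lemma orthogonality_le n m : (m <= n)%nat ->
  dom (fun x => m_poly q a b n x * m_poly q a b m x * w x) /\
  L (fun x => m_poly q a b n x * m_poly q a b m x * w x)
  = Kronecker n m * h_norm q a b n * L w.
Proof.
  intros hmn.
  assert (E : (fun x => m_poly q a b n x * m_poly q a b m x * w x)
              = fun x => Csum (fun k => m_coef m k * m_fun n 0 k x) (S m)).
  { apply functional_extensionality. intros x. rewrite (m_poly_sum m).
    assert (X : forall u v r, (forall k, m_poly q a b n x * u k * w x = v k) ->
               m_poly q a b n x * Csum u r * w x = Csum v r).
    { intros u v r H. induction r as [|r IH]; simpl; [ring|]. rewrite <- IH, <- H. ring. }
    apply X. intros k. unfold m_fun, mom_fun. simpl. ring. }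
  rewrite E. clear E.
  destruct (L_Csum (m_coef m) (m_fun n 0) m) as [A B].
  { intros k hk. apply m_fun_spec. lia. }
  split; [exact A|]. rewrite B. simpl Csum. clear A B.
  assert (Z0 : Csum (fun k => m_coef m k * L (m_fun n 0 k)) m = 0).
  { transitivity (Csum (fun _ => 0) m).
    - apply Csum_ext. intros k hk.
      destruct (m_fun_spec n k 0) as [_ [H _]]; [lia|]. rewrite H by lia. ring.
    - clear. induction m as [|m IH]; simpl; [reflexivity|]. rewrite IH. ring. }
  rewrite Z0. unfold Kronecker. destruct (Nat.eqb_spec n m) as [<-|hne].
  - destruct (m_fun_spec n n 0) as [_ [_ H]]; [lia|]. specialize (H eq_refl).
    destruct (m_fun_row n n) as [_ R]; [lia|].
    assert (R2 := mom_row n).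
    assert (S := qpoch_qinv_sqr n). cbv zeta in S.
    assert (L0 : L (mom_fun 0 0) = L w).
    { f_equal. apply functional_extensionality. intros x. unfold mom_fun. simpl. ring. }
    rewrite L0 in R2. rewrite R in H. simpl pow in H.
    unfold m_coef, sgauss, h_norm. rewrite (RtoC_inv_qpow n) at 2.
    set (z := qpoch q (RtoC (/ q ^ n)%R) n) in *.
    assert (h1 := qpoch_q_neq_0 n). assert (h2 := qpoch_neq_0 b n hb).
    assert (h3 := qpoch_neq_0 a n ha). assert (h4 := qpow_neq_0 q hq n).
    rewrite Cpow_1_l in H.
    set (Q := RtoC (q ^ n)%R) in *.
    transitivity (/ qpoch q a n * (z / qpoch q q n * Q ^ n / qpoch q b n)
       * (a ^ n * 1 * L (m_fun n 0 n))); [field; auto|].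
    rewrite H.
    transitivity (z * z * (Q ^ n * Q) /
        (qpoch q a n * qpoch q a n * qpoch q q n * qpoch q b n * Q)
       * (b ^ n * L (mom_fun n 0))); [field; auto|].
    rewrite S, R2. field; auto.
  - destruct (m_fun_spec n m 0) as [_ [H _]]; [lia|]. rewrite H by lia. ring.
Qed.

Lemma orthogonality n m :
  dom (fun x => m_poly q a b n x * m_poly q a b m x * w x) /\
  L (fun x => m_poly q a b n x * m_poly q a b m x * w x)
  = Kronecker n m * h_norm q a b n * L w.
Proof.
  destruct (Nat.le_ge_cases m n) as [h|h]; [now apply orthogonality_le|].
  destruct (orthogonality_le m n h) as [A B].
  replace (fun x => m_poly q a b n x * m_poly q a b m x * w x)
    with (fun x => m_poly q a b m x * m_poly q a b n x * w x)
    by (apply functional_extensionality; intros; ring).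
  split; [exact A|]. rewrite B. unfold Kronecker. rewrite Nat.eqb_sym.
  destruct (Nat.eqb_spec n m) as [->|]; [reflexivity|ring].
Qed.

End Orthogonality.

(** * Jackson integrals of the weight *)

Section Integrals.
Context (q : R) (hq : (0 < q < 1)%R).

Lemma jackson_term_lin (f g : C -> C) (c e t : C) k :
  jackson_term q (fun x => c * f x + e * g x) t k
  = c * jackson_term q f t k + e * jackson_term q g t k.
Proof. unfold jackson_term. ring. Qed.

Lemma jackson_inf_lin (f g : C -> C) (c e t : C) :
  ex_jackson_inf q f t -> ex_jackson_inf q g t ->
  ex_jackson_inf q (fun x => c * f x + e * g x) t /\
  jackson_inf q (fun x => c * f x + e * g x) t
      = c * jackson_inf q f t + e * jackson_inf q g t.
Proof.
  intros Hf Hg. unfold ex_jackson_inf, jackson_inf in *.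
  assert (E := jackson_term_lin f g c e t).
  assert (Sf := abs_summableZ_scal c _ Hf). assert (Sg := abs_summableZ_scal e _ Hg).
  split.
  - apply abs_summableZ_ext with (1 := fun k => eq_sym (E k)).
    now apply abs_summableZ_plus.
  - rewrite (CSeriesZ_ext _ _ E).
    rewrite (CSeriesZ_plus (fun k => c * jackson_term q f t k)) by assumption.
    rewrite !CSeriesZ_scal by assumption. ring.
Qed.

Lemma jackson_lin (f g : C -> C) (c e t : C) :
  ex_jackson q f t -> ex_jackson q g t ->
  ex_jackson q (fun x => c * f x + e * g x) t /\
  jackson q (fun x => c * f x + e * g x) t = c * jackson q f t + e * jackson q g t.
Proof.
  intros Hf Hg. unfold ex_jackson, jackson in *.
  assert (E := fun k => jackson_term_lin f g c e t (Z.of_nat k)).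
  assert (Sf := abs_summable_scal c _ Hf). assert (Sg := abs_summable_scal e _ Hg).
  split.
  - apply abs_summable_ext with (1 := fun k => eq_sym (E k)).
    now apply (abs_summable_plus (fun k => c * jackson_term q f t (Z.of_nat k))).
  - rewrite (CSeries_ext _ _ E).
    rewrite (CSeries_plus (fun k => c * jackson_term q f t (Z.of_nat k))) by assumption.
    rewrite (CSeries_scal c (fun k => jackson_term q f t (Z.of_nat k))) by assumption.
    rewrite (CSeries_scal e (fun k => jackson_term q g t (Z.of_nat k))) by assumption.
    ring.
Qed.

Lemma jackson_inf_moment (a b t : C) i j : a <> 0 -> b <> 0 -> t <> 0 -> regular_on q a b t ->
  ex_jackson_inf q (mom_fun q a b (weight q a b) i j) t /\
  jackson_inf q (mom_fun q a b (weight q a b) i j) t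
  = (1 - q) * sum_two_sided q (a * RtoC (q ^ i)%R) (b * RtoC (q ^ j)%R) t.
Proof.
  intros ha hb ht H.
  assert (E : forall k,
     jackson_term q (weight q (a * RtoC (q ^ i)%R) (b * RtoC (q ^ j)%R)) t k
     = jackson_term q (mom_fun q a b (weight q a b) i j) t k).
  { intros k. unfold jackson_term, mom_fun. now rewrite weight_shift. }
  destruct (sum_two_sided_spec q hq (a * RtoC (q ^ i)%R) (b * RtoC (q ^ j)%R) t) as [S _];
    auto using Cmult_neq_0, qpow_neq_0, regular_on_shift.
  split.
  - now apply abs_summableZ_ext with (1 := E).
  - unfold jackson_inf. now rewrite <- (CSeriesZ_ext _ _ E).
Qed.

Lemma jackson_moment (a b : C) i j : regular_half q a b ->
  ex_jackson q (mom_fun q a b (weight q a b) i j) (-1) /\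
  jackson q (mom_fun q a b (weight q a b) i j) (-1)
  = (1 - q) * sum_one_sided q (a * RtoC (q ^ i)%R) (b * RtoC (q ^ j)%R).
Proof.
  intros H.
  assert (E : forall k,
     jackson_term q (weight q (a * RtoC (q ^ i)%R) (b * RtoC (q ^ j)%R)) (-1) (Z.of_nat k)
     = jackson_term q (mom_fun q a b (weight q a b) i j) (-1) (Z.of_nat k)).
  { intros k. unfold jackson_term, mom_fun. now rewrite weight_shift. }
  split.
  - apply abs_summable_ext with (1 := E). now apply sum_one_sided_summable.
  - unfold jackson. now rewrite <- (CSeries_ext _ _ E).
Qed.

Lemma qpow_shift_S (a : C) i : a * RtoC (q ^ S i)%R = a * RtoC (q ^ i)%R * q.
Proof. rewrite qpow_S. ring. Qed.

Lemma sum_two_sided_moment_r (a b t : C) i j : a <> 0 -> b <> 0 -> t <> 0 -> regular_on q a b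
    t ->
  a * RtoC (q ^ i)%R * sum_two_sided q (a * RtoC (q ^ i)%R) (b * RtoC (q ^ S j)%R) t
  = (1 - b * RtoC (q ^ j)%R) * sum_two_sided q (a * RtoC (q ^ i)%R) (b * RtoC (q ^ j)%R) t
      + 1.
Proof.
  intros ha hb ht H. rewrite qpow_shift_S.
  assert (R := sum_two_sided_recurrence_r q hq (a * RtoC (q ^ i)%R) (b * RtoC (q ^ j)%R) t).
  match type of R with _ -> _ -> _ -> _ -> ?X - ?Y = _ => transitivity (X - (X - Y)) end;
    [ring|].
  rewrite R; auto using Cmult_neq_0, qpow_neq_0, regular_on_shift. ring.
Qed.

Lemma sum_one_sided_moment_r (a b : C) i j : regular_half q a b ->
  a * RtoC (q ^ i)%R * sum_one_sided q (a * RtoC (q ^ i)%R) (b * RtoC (q ^ S j)%R)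
  = (1 - b * RtoC (q ^ j)%R) * sum_one_sided q (a * RtoC (q ^ i)%R) (b * RtoC (q ^ j)%R) + 1.
Proof.
  intros H. rewrite qpow_shift_S.
  assert (R := sum_one_sided_recurrence_r q hq (a * RtoC (q ^ i)%R) (b * RtoC (q ^ j)%R)).
  match type of R with _ -> ?X - ?Y = _ => transitivity (X - (X - Y)) end; [ring|].
  rewrite R by now apply regular_half_shift. ring.
Qed.

End Integrals.

Theorem proposition2p3 (q : R) (hq : (0 < q < 1)%R) (a b : C)
    (ha0 : a <> 0) (hb0 : b <> 0)
    (ha : forall k : nat, a <> RtoC (/ q ^ k)%R)
    (hb : forall k : nat, b <> RtoC (/ q ^ k)%R) :
  (forall tm tp : R, (tm < 0)%R -> (0 < tp)%R ->
    (forall x : C,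
      (exists k : Z, x = qgrid q tm k \/ x = qgrid q tp k) ->
      qpoch_inf q (- a * x) * qpoch_inf q (- b * x) <> 0) ->
    forall n m : nat,
      let f := fun x : C => m_poly q a b n x * m_poly q a b m x * weight q a b x in
      ex_jackson_inf q f tp /\ ex_jackson_inf q f tm /\
      jackson_inf_inf q f tm tp
      = Kronecker n m * h_norm q a b n * mass2 q a b tm tp)
  /\
  (forall t : R, (0 < t)%R ->
    (forall x : C,
      (exists k : nat, x = qgrid q (-1) (Z.of_nat k)) \/
      (exists k : Z, x = qgrid q t k) ->
      qpoch_inf q (- a * x) * qpoch_inf q (- b * x) <> 0) ->
    forall n m : nat,
      let f := fun x : C => m_poly q a b n x * m_poly q a b m x * weight q a b x in
      ex_jackson_inf q f t /\ ex_jackson q f (-1) /\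
      jackson_pt_inf q f (-1) t
      = Kronecker n m * h_norm q a b n * mass1 q a b t).
Proof.
  split.
  - intros tm tp htm htp H n m f.
    assert (hm : RtoC tm <> 0) by (intros E; apply RtoC_inj in E; lra).
    assert (hp : RtoC tp <> 0) by (intros E; apply RtoC_inj in E; lra).
    assert (Rm : regular_on q a b tm).
    { intros k. apply Cmult_neq_0_inv, H. exists k. now left. }
    assert (Rp : regular_on q a b tp).
    { intros k. apply Cmult_neq_0_inv, H. exists k. now right. }
    destruct (orthogonality q hq a b ha0 ha hb
       (fun g => ex_jackson_inf q g tp /\ ex_jackson_inf q g tm)
       (fun g => jackson_inf_inf q g tm tp) (weight q a b)) with (n := n) (m := m) as
           [[D1 D2] V].
    + intros g h c e [G1 G2] [H1 H2].
      destruct (jackson_inf_lin q g h c e tp G1 H1) as [A1 B1].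
      destruct (jackson_inf_lin q g h c e tm G2 H2) as [A2 B2].
      split; [now split|]. unfold jackson_inf_inf. rewrite B1, B2. ring.
    + intros i j. split; now apply jackson_inf_moment.
    + intros i j. unfold jackson_inf_inf.
      rewrite !(proj2 (jackson_inf_moment q hq a b _ _ _ ha0 hb0 hp Rp)).
      rewrite !(proj2 (jackson_inf_moment q hq a b _ _ _ ha0 hb0 hm Rm)).
      assert (E1 := sum_two_sided_moment_r q hq b a tp j i hb0 ha0 hp
          (regular_on_sym q _ _ _ Rp)).
      assert (E2 := sum_two_sided_moment_r q hq b a tm j i hb0 ha0 hm
          (regular_on_sym q _ _ _ Rm)).
      rewrite !(sum_two_sided_sym q (b * _)) in E1, E2.
      match goal with |- ?B * (?r * ?X - ?r * ?Y) = _ =>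
        transitivity (r * (B * X - B * Y)); [ring|] end.
      rewrite E1, E2. ring.
    + intros i j. unfold jackson_inf_inf.
      rewrite !(proj2 (jackson_inf_moment q hq a b _ _ _ ha0 hb0 hp Rp)).
      rewrite !(proj2 (jackson_inf_moment q hq a b _ _ _ ha0 hb0 hm Rm)).
      assert (E1 := sum_two_sided_moment_r q hq a b tp i j ha0 hb0 hp Rp).
      assert (E2 := sum_two_sided_moment_r q hq a b tm i j ha0 hb0 hm Rm).
      match goal with |- ?B * (?r * ?X - ?r * ?Y) = _ =>
        transitivity (r * (B * X - B * Y)); [ring|] end.
      rewrite E1, E2. ring.
    + split; [exact D1|split; [exact D2|]]. unfold f. rewrite V. f_equal.
      rewrite <- (mass2_spec q hq a b tm tp) by assumption.
      unfold jackson_inf_inf, jackson_inf, sum_two_sided. ring.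
  - intros t ht H n m f.
    assert (ht0 : RtoC t <> 0) by (intros E; apply RtoC_inj in E; lra).
    assert (Rh : regular_half q a b).
    { intros k. apply Cmult_neq_0_inv, H. left. now exists k. }
    assert (Rt : regular_on q a b t).
    { intros k. apply Cmult_neq_0_inv, H. right. now exists k. }
    destruct (orthogonality q hq a b ha0 ha hb
       (fun g => ex_jackson_inf q g t /\ ex_jackson q g (-1))
       (fun g => jackson_pt_inf q g (-1) t) (weight q a b)) with (n := n) (m := m) as
           [[D1 D2] V].
    + intros g h c e [G1 G2] [H1 H2].
      destruct (jackson_inf_lin q g h c e t G1 H1) as [A1 B1].
      destruct (jackson_lin q g h c e (-1) G2 H2) as [A2 B2].
      split; [now split|]. unfold jackson_pt_inf. rewrite B1, B2. ring.
    + intros i j. split; [now apply jackson_inf_moment|now apply jackson_moment].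
    + intros i j. unfold jackson_pt_inf.
      rewrite !(proj2 (jackson_inf_moment q hq a b _ _ _ ha0 hb0 ht0 Rt)).
      rewrite !(proj2 (jackson_moment q hq a b _ _ Rh)).
      assert (E1 := sum_two_sided_moment_r q hq b a t j i hb0 ha0 ht0
          (regular_on_sym q _ _ _ Rt)).
      assert (E2 := sum_one_sided_moment_r q hq b a j i (regular_half_sym q _ _ Rh)).
      rewrite !(sum_two_sided_sym q (b * _)) in E1.
      rewrite !(sum_one_sided_sym q (b * _)) in E2.
      match goal with |- ?B * (?r * ?X - ?r * ?Y) = _ =>
        transitivity (r * (B * X - B * Y)); [ring|] end.
      rewrite E1, E2. ring.
    + intros i j. unfold jackson_pt_inf.
      rewrite !(proj2 (jackson_inf_moment q hq a b _ _ _ ha0 hb0 ht0 Rt)).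
      rewrite !(proj2 (jackson_moment q hq a b _ _ Rh)).
      assert (E1 := sum_two_sided_moment_r q hq a b t i j ha0 hb0 ht0 Rt).
      assert (E2 := sum_one_sided_moment_r q hq a b i j Rh).
      match goal with |- ?B * (?r * ?X - ?r * ?Y) = _ =>
        transitivity (r * (B * X - B * Y)); [ring|] end.
      rewrite E1, E2. ring.
    + split; [exact D1|split; [exact D2|]]. unfold f. rewrite V. f_equal.
      assert (M := mass1_spec q hq a b t t eq_refl ht ha0 hb0 ha hb Rh Rt).
      transitivity ((1 - q) * (sum_two_sided q a b t - sum_one_sided q a b)).
      * unfold jackson_pt_inf, jackson_inf, jackson, sum_two_sided, sum_one_sided. ring.
      * rewrite M. unfold mass1_sum, mass1. ring.
Qed.
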